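(* The incompressible Navier-Stokes equations $$u_t-\nu\Delta u+(u\cdot\nabla)u+\nabla P=0,\qquad\nabla\cdot u=0$$ (with viscosity $\nu>0$) with periodic boundary condition $u(t,x+2\pi)=u(t,x)$ for all $t\ge0$, $x\in\mathbb{R}^3$, and initial data $u(t,x)|_{t=0}=u_0(x)$, are globally well-posed provided $u_0\in B$. Here the subset $B$ of $C^\infty_{per}$ is defined by $$B=\bigcup_{A(\nabla)}\ \bigcup_{n=1,2,\dots}\big\{u(x)\ \big|\ u=\lambda_nA(\nabla)\psi_n(x)+\{A(\nabla)\times\nabla\}\psi_n(x),\ \forall\psi_n\in E_n\big\},$$ where $A(\nabla)$ ranges over all polynomial operators described in the context.
   Context: Here $x=(x_1,x_2,x_3)$, $\nabla=(\partial_1,\partial_2,\partial_3)$, $\partial_j=\partial/\partial x_j$; $u$ is the velocity, $P$ the pressure; $f(x+2\pi)=f(x)$ means $f$ is $2\pi$-periodic in each of $x_1,x_2,x_3$; $C^\infty_{per}$ is the space of smooth $2\pi$-periodic vector fields on $\mathbb{R}^3$. The operators $A(\nabla)=(a_1(\nabla),a_2(\nabla),a_3(\nabla))$ are those of the form $(p_1(\nabla),p_2(\nabla),p_3(\nabla))$, where $p_1,p_2,p_3$ are polynomials with $x_1p_1(x)+x_2p_2(x)+x_3p_3(x)\equiv0$ for all $x\in\mathbb{R}^3$, and $p_j(\nabla)$ is obtained by substituting $\partial_k$ for $x_k$ (Fourier symbol $p_j(i\xi)$). The operator $A(\nabla)$ and the functions $\psi_n$ are real. Write $A(\nabla)\psi=(a_1(\nabla)\psi,a_2(\nabla)\psi,a_3(\nabla)\psi)$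 and $$\{A(\nabla)\times\nabla\}\psi=\big((a_2(\nabla)\partial_3-a_3(\nabla)\partial_2)\psi,\ (a_3(\nabla)\partial_1-a_1(\nabla)\partial_3)\psi,\ (a_1(\nabla)\partial_2-a_2(\nabla)\partial_1)\psi\big).$$ $0\le\lambda_1\le\cdots\le\lambda_n\le\cdots$ are the eigenvalues of the problem $-\Delta\psi=\lambda^2\psi$, $\psi(x+2\pi)=\psi(x)$ for all $x\in\mathbb{R}^3$, and $E_n$ is the linear space of all eigenfunctions $\psi_n$ corresponding to the eigenvalue $\lambda_n$. *)

(* Defs.v *)
From HB Require Import structures.
From mathcomp Require Import all_boot all_order all_algebra.
From mathcomp Require Import all_classical all_reals all_analysis.
(* not imported: the notations of mpoly clash with those of analysis *)
From mathcomp Require mpoly.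
Set Implicit Arguments.
Unset Strict Implicit.
Unset Printing Implicit Defensive.
Import Order.TTheory GRing.Theory Num.Theory.
Import numFieldNormedType.Exports.
Local Open Scope classical_set_scope.
Local Open Scope ring_scope.

Section Space.
Context {R : realType}.
Local Notation E := 'rV[R]_3.

Definition basis_vec (j : 'I_3) : E := delta_mx 0 j.

Definition partial (j : 'I_3) (f : E -> R) : E -> R :=
  fun x => 'D_(basis_vec j) f x.

Definition partials (s : seq 'I_3) (f : E -> R) : E -> R :=
  foldr partial f s.

Definition laplacian (f : E -> R) : E -> R :=
  fun x => \sum_(j < 3) partial j (partial j f) x.

Definition ucomp (j : 'I_3) (u : E -> E) : E -> R := fun x => u x 0 j.

Definition divergence (u : E -> E) : E -> R :=
  fun x => \sum_(j < 3) partial j (ucomp j u) x.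

Definition smooth (f : E -> R) : Prop :=
  forall s : seq 'I_3, continuous (partials s f) /\
    forall x j, derivable (partials s f) x (basis_vec j).

Definition periodic2pi {T : Type} (f : E -> T) : Prop :=
  forall (x : E) j, f (x + (2 * pi) *: basis_vec j) = f x.

Definition mpartial (m : mpoly.multinom 3) (f : E -> R) : E -> R :=
  foldr (fun j g => iter (mpoly.fun_of_multinom m j) (partial j) g) f (enum 'I_3).

(* p(nabla): the derivative partial j is substituted for the j-th variable *)
Definition poly_op (p : mpoly.mpoly 3 R) (f : E -> R) : E -> R :=
  fun x => \sum_(m <- mpoly.msupp p) mpoly.mcoeff m p * mpartial m f x.

(* x_1 p_1(x) + x_2 p_2(x) + x_3 p_3(x) = 0 identically on R^3 *)
Definition admissible (p : 'I_3 -> mpoly.mpoly 3 R) : Prop :=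
  forall x : 'I_3 -> R, \sum_(j < 3) x j * mpoly.meval x (p j) = 0.

Definition op_apply (p : 'I_3 -> mpoly.mpoly 3 R) (psi : E -> R) : E -> E :=
  fun x => \row_j poly_op (p j) psi x.

(* {A(nabla) x nabla} psi; the additions j + 1 and j + 2 in 'I_3 are modulo 3,
   so that (j, j + 1, j + 2) runs through the cyclic permutations *)
Definition op_cross_nabla (p : 'I_3 -> mpoly.mpoly 3 R) (psi : E -> R)
    : E -> E :=
  fun x => \row_j (poly_op (p (j + 1)) (partial (j + 2) psi) x
                   - poly_op (p (j + 2)) (partial (j + 1) psi) x).

(* Smoothness loses nothing: C^2 solutions are smooth by elliptic regularity. *)
Definition laplace_eigenspace (l : R) : set (E -> R) :=
  [set psi | [/\ smooth psi, periodic2pi psi &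
                 forall x, - laplacian psi x = l ^+ 2 * psi x]].

(* The eigenvalue parameter is l, not l ^ 2. *)
Definition laplace_eigenvalues : set R :=
  [set l | 0 <= l /\
           exists2 psi, laplace_eigenspace l psi & exists x, psi x != 0].

(* lam 0 <= lam 1 <= ... lists the eigenvalues; an eigenvalue may be repeated
   (with its multiplicity, or not at all). The numbering starts at 0. *)
Definition eigenvalue_enumeration (lam : nat -> R) : Prop :=
  nondecreasing_seq lam /\ range lam = laplace_eigenvalues.

Definition initial_data_B (lam : nat -> R) : set (E -> E) :=
  \bigcup_(p in admissible) \bigcup_(n in [set: nat])
    [set u | exists2 psi, laplace_eigenspace (lam n) psi &
       u = (fun x => lam n *: op_apply p psi x + op_cross_nabla p psi x)].

(* u and v are e-close in the C^m norm *)
Definition Cclose (m : nat) (e : R) (u v : E -> E) : Prop :=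
  forall s : seq 'I_3, (size s <= m)%N -> forall x j,
    `|partials s (ucomp j u) x - partials s (ucomp j v) x| < e.

End Space.

Section NavierStokes.
Context {R : realType}.
Local Notation E := 'rV[R]_3.

Definition dt (f : R -> E -> R) : R -> E -> R :=
  fun t x => derive1 (f ^~ x) t.

(* None stands for the time derivative, Some j for the j-th space derivative *)
Definition stpartial (o : option 'I_3) (f : R -> E -> R) : R -> E -> R :=
  if o is Some j then fun t => partial j (f t) else dt f.

Definition stderivable (o : option 'I_3) (f : R -> E -> R) (t : R) (x : E) :
    Prop :=
  if o is Some j then derivable (f t) x (basis_vec j)
  else derivable (f ^~ x) t 1.

Definition stpartials (s : seq (option 'I_3)) (f : R -> E -> R) :
  R -> E -> R := foldr stpartial f s.

Definition half_space : set (R * E) := [set z | 0 <= z.1].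

Definition continuous_half_space (f : R -> E -> R) : Prop :=
  {within half_space, continuous (fun z => f z.1 z.2)}.

(* f is C^oo on [0, +oo[ x R^3: f is continuous there, all its iterated partial
   derivatives exist for t > 0 and extend continuously to t = 0. The values of
   f for t < 0 are irrelevant. *)
Definition smooth_half_space (f : R -> E -> R) : Prop :=
  continuous_half_space f /\
  forall s : seq (option 'I_3),
    (forall o t x, 0 < t -> stderivable o (stpartials s f) t x) /\
    (exists2 g : R -> E -> R, continuous_half_space g &
       forall t x, 0 < t -> g t x = stpartials s f t x).

Definition NS_momentum (nu : R) (u : R -> E -> E) (P : R -> E -> R)
    (t : R) (x : E) (j : 'I_3) : R :=
  dt (fun s => ucomp j (u s)) t x
  - nu * laplacian (ucomp j (u t)) x
  + \sum_(k < 3) u t x 0 k * partial k (ucomp j (u t)) x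
  + partial j (P t) x.

(* Global smooth solutions. Being smooth up to t = 0, they satisfy the momentum
   equation at t = 0 as well, with the continuous extensions of the derivatives.
   The pressure is periodic: otherwise u(t, x) = c(t), P(t, x) = - c'(t) . x
   with c(0) = 0 would violate uniqueness. *)
Definition NS_solution (nu : R) (u0 : E -> E) (u : R -> E -> E)
    (P : R -> E -> R) : Prop :=
  [/\ (forall j, smooth_half_space (fun t => ucomp j (u t))) /\
      smooth_half_space P,
      forall t, 0 <= t -> periodic2pi (u t) /\ periodic2pi (P t),
      forall t x j, 0 < t -> NS_momentum nu u P t x j = 0,
      forall t x, 0 <= t -> divergence (u t) x = 0 &
      forall x, u 0 x = u0 x].

(* Hadamard well-posedness for initial data in D, with the topology of C^oo_per
   on the data and of C([0, T]; C^oo_per), T arbitrary, on the solutions. The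
   pressure is unique up to a function of time. *)
Definition globally_well_posed (nu : R) (D : set (E -> E)) : Prop :=
  [/\ forall u0, D u0 -> exists u P, NS_solution nu u0 u P,
      forall u0, D u0 -> forall u P v Q,
        NS_solution nu u0 u P -> NS_solution nu u0 v Q ->
        (forall t x, 0 <= t -> u t x = v t x) /\
        (forall t x y, 0 <= t -> P t x - Q t x = P t y - Q t y) &
      forall u0, D u0 -> forall (T : R) (m : nat) (e : R), 0 < T -> 0 < e ->
        exists k : nat, exists2 d : R, 0 < d &
          forall v0, D v0 -> Cclose k d u0 v0 -> forall u P v Q,
            NS_solution nu u0 u P -> NS_solution nu v0 v Q ->
            forall t, 0 <= t <= T -> Cclose m e (u t) (v t)].

End NavierStokes.

(* Main.v *)
Require Import Defs.
From mathcomp Require Import all_boot all_order all_algebra.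
From mathcomp Require Import all_classical all_reals all_analysis.
From mathcomp Require Import zify ring lra.
From mathcomp Require mpoly.
Import (canonicals) mpoly.

(** The fields of B are Beltrami fields. With alpha_j = p_j(nabla) psi they read
    u0 = l alpha - curl alpha. The relation between the p_j makes alpha
    solenoidal ([admissible_divergence]) and alpha inherits the equation
    - Lap alpha = l^2 alpha from psi, so that curl curl alpha = l^2 alpha and
    curl u0 = - l u0 ([beltrami_potential]).
    Then (u0 . nabla) u0 = nabla |u0|^2 / 2, the advection is absorbed by the
    pressure, and exp (- nu l^2 t) u0 solves the Navier-Stokes equations for all
    times ([beltrami_NS_solution]).

    The explicit solution also settles uniqueness. If v is another solution with
    the same data, w = v - u satisfies d|w|^2/dt <= 6 M |w|^2 + div Phi, where M
    bounds the gradient of u and Phi is a periodic flux ([energy_inequality]),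
    whence w = 0 by Gronwall's argument ([NS_unique]). Integration over the
    torus is replaced by means over finitely many translates. Say that f has
    nonpositive mean if, for every e > 0, some mean of translates of f is at
    most e everywhere. This property is stable under sums, holds for
    derivatives of periodic functions ([mean_nonpos_partial]), and holds for a
    nonnegative continuous periodic function only if it is 0
    ([mean_nonpos_eq0]). The time integral becomes a Riemann sum
    ([zero_evolution]).

    By uniqueness, continuous dependence concerns the explicit solutions only:
    the difference of two decay rates is controlled by the Laplacian of the
    difference of the data ([decaying_flow_stable]). *)

Set Implicit Arguments.
Unset Strict Implicit.
Unset Printing Implicit Defensive.
Import Order.TTheory GRing.Theory Num.Theory.
Import numFieldNormedType.Exports.
Local Open Scope classical_set_scope.
Local Open Scope ring_scope.

(** * Partial derivatives and smooth functions *)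

Section Calculus.
Context {R : realType}.
Local Notation E := 'rV[R]_3.
Implicit Types (f g : E -> R) (x v w : E).

Lemma is_derive_line f x v (s : R) : derivable f (x + s *: v) v ->
  is_derive s 1 (fun r : R => f (x + r *: v)) ('D_v f (x + s *: v)).
Proof.
move=> df.
have eq : (fun h : R => h^-1 *: ((f \o shift (x + s *: v)) (h *: v) -
            f (x + s *: v))) =
          (fun h : R => h^-1 *: (((fun r : R => f (x + r *: v)) \o shift s) (h *: 1)
           - f (x + s *: v))).
  apply/funext => h /=; congr (_ *: (f _ - _)).
  by rewrite [h *: 1]mulr1 scalerDl addrCA addrA.
split; first by rewrite /derivable -eq.
by rewrite /derive -eq.
Qed.

Lemma mvt_line f x v (h : R) : (forall y, derivable f y v) ->
  exists2 c : R, `|c| <= `|h| & f (x + h *: v) - f x = h * 'D_v f (x + c *: v).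
Proof.
move=> df; pose g r := f (x + r *: v).
have dg (s : R) : is_derive s 1 g ('D_v f (x + s *: v)) by exact: is_derive_line.
have cg (A : set R) : {within A, continuous g}.
  apply: continuous_subspaceT => s.
  by apply/differentiable_continuous/derivable1_diffP; case: (dg s).
have g0 : f x = g 0 by rewrite /g scale0r addr0.
rewrite g0; have [h0|h0] := leP 0 h.
  have [c] := MVT_segment h0 (fun s _ => dg s) (cg _).
  rewrite in_itv /= => /andP[c0 ch] e; exists c.
    by rewrite !ger0_norm.
  by rewrite mulrC -[h in RHS]subr0 -e.
have [c] := MVT_segment (ltW h0) (fun s _ => dg s) (cg _).
rewrite in_itv /= => /andP[c0 ch] e; exists c.
  by rewrite (ler0_norm (ltW h0)) ler0_norm // lerN2.
by rewrite /g -/(g 0) -/(g h) -opprB e sub0r mulrN opprK mulrC.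
Qed.

Lemma dist_le_via (e a b c d : R) :
  c = d -> `|a - c| < e / 2 -> `|b - d| < e / 2 -> `|a - b| <= e.
Proof.
move=> <- ac bc; rewrite [e]splitr -[X in X - _](subrK c) -addrA ltW //.
by apply: le_lt_trans (ler_normD _ _) _; rewrite ltrD // distrC.
Qed.

(** Two applications of the mean value theorem, first along v to the difference
    f (y + k w) - f y, then along w. *)
Lemma second_difference f x v w (h k : R) :
  (forall y, derivable f y v) -> (forall y, derivable ('D_v f) y w) ->
  exists c d : R, [/\ `|c| <= `|h|, `|d| <= `|k| &
    f (x + h *: v + k *: w) - f (x + h *: v) - f (x + k *: w) + f x
    = h * k * 'D_w ('D_v f) (x + c *: v + d *: w)].
Proof.
move=> df ddf; pose p := (f \o shift (k *: w)) - f.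
have dsh y : is_derive y v (f \o shift (k *: w)) ('D_v f (y + k *: w)).
  have e : (fun h : R => h^-1 *: (((f \o shift (k *: w)) \o shift y) (h *: v)
             - (f \o shift (k *: w)) y)) =
           (fun h : R => h^-1 *: ((f \o shift (y + k *: w)) (h *: v)
             - f (y + k *: w))).
    by apply/funext => r /=; rewrite addrA.
  by split; rewrite /derivable /derive e //; exact: df.
have dp y : is_derive y v p ('D_v f (y + k *: w) - 'D_v f y).
  by apply: is_deriveB; exact/derivableP.
have [c ch ec] := @mvt_line p x v h (fun y => @ex_derive _ _ _ _ _ _ _ (dp y)).
have [d dk ed] := @mvt_line ('D_v f) (x + c *: v) w k ddf.
exists c, d; split => //.
move: ec; rewrite (@derive_val _ _ _ _ _ _ _ (dp (x + c *: v))) ed mulrA => <-.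
rewrite /p /= !fctE /= /shift; ring.
Qed.

(** Both mixed derivatives are limits of the same second difference divided by
    h^2, taken at points which tend to x with h. *)
Lemma schwarz f x v w :
  (forall y, derivable f y v) -> (forall y, derivable ('D_v f) y w) ->
  (forall y, derivable f y w) -> (forall y, derivable ('D_w f) y v) ->
  {for x, continuous ('D_w ('D_v f))} -> {for x, continuous ('D_v ('D_w f))} ->
  'D_w ('D_v f) x = 'D_v ('D_w f) x.
Proof.
move=> dv dvw dw dwv c1 c2.
apply/eqP; rewrite eq_le; apply/andP.
suff P e : 0 < e -> `|'D_w ('D_v f) x - 'D_v ('D_w f) x| <= e.
  have : `|'D_w ('D_v f) x - 'D_v ('D_w f) x| <= 0.
    by apply/ler_addgt0Pr => e e0; rewrite add0r; exact: P.
  by rewrite normr_le0 subr_eq0 => /eqP ->.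
move=> e0; have e2 : 0 < e / 2 by rewrite divr_gt0.
move/cvgrPdist_lt/(_ _ e2)/nbhs_ballP : c1 => [d1 /= d10 H1].
move/cvgrPdist_lt/(_ _ e2)/nbhs_ballP : c2 => [d2 /= d20 H2].
have m0 : 0 < Num.min d1 d2 by rewrite lt_min d10 d20.
have [M eM'] : exists M, `|v| + `|w| + 1 = M by eexists.
have M0 : 0 < M by rewrite -eM' ltr_wpDl // addr_ge0.
have [h h0 hM] : exists2 h : R, 0 < h & h * M < Num.min d1 d2.
  exists (Num.min d1 d2 / M / 2); first by rewrite !divr_gt0.
  by rewrite mulrAC divfK ?gt_eqF // ltr_pdivrMr // ltr_pMr //; lra.
have near_x c d v' w' : `|v'| + `|w'| + 1 = M -> `|c| <= `|h| -> `|d| <= `|h| ->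
    `|x - (x + c *: v' + d *: w')| < Num.min d1 d2.
  move=> eM ch dh; rewrite -addrA opprD addrA subrr add0r normrN.
  apply: le_lt_trans (ler_normD _ _) _; rewrite !normrZ.
  apply: (@le_lt_trans _ _ (h * M)).
    rewrite -eM -addrA mulrDr lerD //.
      by rewrite ler_wpM2r // -[h in leRHS]gtr0_norm.
    rewrite mulrDr -[leLHS]addr0 lerD //.
      by rewrite ler_wpM2r // -[h in leRHS]gtr0_norm.
    by rewrite mulr1 ltW.
  exact: hM.
have [c [d [ch dh S1]]] := @second_difference f x v w h h dv dvw.
have [c' [d' [ch' dh' S2]]] := @second_difference f x w v h h dw dwv.
have hh : h * h != 0 by rewrite mulf_neq0 // gt_eqF.
have eqD : 'D_w ('D_v f) (x + c *: v + d *: w) =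
           'D_v ('D_w f) (x + c' *: w + d' *: v).
  apply: (mulfI hh); apply: etrans (esym S1) (etrans _ S2).
  by rewrite [x + h *: w + h *: v]addrAC; congr (_ + _); rewrite -!addrA [- _ - _]addrC.
have L1 : `|'D_w ('D_v f) x - 'D_w ('D_v f) (x + c *: v + d *: w)| < e / 2.
  apply: H1; rewrite -ball_normE /=.
  by have := near_x c d v w eM' ch dh; rewrite lt_min => /andP[].
have L2 : `|'D_v ('D_w f) x - 'D_v ('D_w f) (x + c' *: w + d' *: v)| < e / 2.
  apply: H2; rewrite -ball_normE /=.
  have eM : `|w| + `|v| + 1 = M by rewrite -eM' [X in X + 1]addrC.
  by have := near_x c' d' w v eM ch' dh'; rewrite lt_min => /andP[].
exact: dist_le_via eqD L1 L2.
Qed.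

Lemma partials_cat (s t : seq 'I_3) f :
  partials (s ++ t) f = partials s (partials t f).
Proof. exact: foldr_cat. Qed.

Lemma smooth_continuous f : smooth f -> continuous f.
Proof. by move=> /(_ [::])[]. Qed.

Lemma smooth_derivable f x j : smooth f -> derivable f x (basis_vec j).
Proof. by move=> /(_ [::])[_ /(_ x j)]. Qed.

Lemma smooth_partials s f : smooth f -> smooth (partials s f).
Proof. by move=> sf t; rewrite -partials_cat; exact: sf. Qed.

Lemma smooth_partial j f : smooth f -> smooth (partial j f).
Proof. exact: (@smooth_partials [:: j]). Qed.

Lemma partialC i j f : smooth f ->
  partial i (partial j f) = partial j (partial i f).
Proof.
move=> sf; apply/funext => x; rewrite /partial.
have sd k y : derivable f y (basis_vec k) by exact: smooth_derivable.
have sdd k l y : derivable (partial l f) y (basis_vec k).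
  exact/smooth_derivable/smooth_partial.
have sc k l : continuous (partial k (partial l f)).
  exact/smooth_continuous/smooth_partial/smooth_partial.
exact: (schwarz (sd j) (sdd i j) (sd i) (sdd j i) (sc _ _ _) (sc _ _ _)).
Qed.

Local Opaque partial.
Lemma partials_partial s j f : smooth f ->
  partials s (partial j f) = partial j (partials s f).
Proof.
move=> sf; elim: s => [//|i s IH] /=.
by rewrite IH (@partialC i j (partials s f)) //; exact: smooth_partials.
Qed.

Local Transparent partial.

Lemma partialD j f g : smooth f -> smooth g ->
  partial j (f + g) = partial j f + partial j g.
Proof.
move=> sf sg; apply/funext=> x.
by rewrite /partial deriveD //; exact: smooth_derivable.
Qed.

Lemma partialZ j (k : R) f : smooth f -> partial j (k *: f) = k *: partial j f.
Proof.
move=> sf; apply/funext=> x.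
by rewrite /partial deriveZ //; exact: smooth_derivable.
Qed.

Lemma partialM j f g : smooth f -> smooth g ->
  partial j (f * g) = partial j f * g + f * partial j g.
Proof.
move=> sf sg; apply/funext=> x; rewrite /partial deriveM; try exact: smooth_derivable.
by rewrite addrC; congr (_ + _); exact: mulrC.
Qed.

Lemma partial_cst j (k : R) : partial j (cst k) = 0.
Proof. by apply/funext=> x; rewrite /partial derive_cst. Qed.

(** The ring generated by a class of smooth functions: by the sum and product
    rules it is stable under partial derivatives, which is why all its members
    are smooth. *)
Inductive smooth_ring : (E -> R) -> Prop :=
| SmoothGen f of smooth f : smooth_ring f
| SmoothAdd f g of smooth_ring f & smooth_ring g : smooth_ring (f + g)
| SmoothMul f g of smooth_ring f & smooth_ring g : smooth_ring (f * g).

Lemma smooth_ring_C1 f : smooth_ring f ->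
  continuous f /\ forall x j, derivable f x (basis_vec j).
Proof.
elim=> {f} [f sf|f g _ [cf df] _ [cg dg]|f g _ [cf df] _ [cg dg]]; split.
- exact: smooth_continuous.
- by move=> x j; exact: smooth_derivable.
- by move=> x; exact: (continuousD (cf x) (cg x)).
- by move=> x j; exact: (derivableD (df x j) (dg x j)).
- by move=> x; exact: (continuousM (cf x) (cg x)).
- by move=> x j; exact: (derivableM (df x j) (dg x j)).
Qed.

Lemma smooth_ring_partial j f : smooth_ring f -> smooth_ring (partial j f).
Proof.
elim=> {f} [f sf|f g rf df rg dg|f g rf df rg dg].
- exact/SmoothGen/smooth_partial.
- have -> : partial j (f + g) = partial j f + partial j g.
    apply/funext => x.
    exact: (deriveD ((smooth_ring_C1 rf).2 x j) ((smooth_ring_C1 rg).2 x j)).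
  exact: SmoothAdd.
- have -> : partial j (f * g) = f * partial j g + g * partial j f.
    apply/funext => x.
    exact: (deriveM ((smooth_ring_C1 rf).2 x j) ((smooth_ring_C1 rg).2 x j)).
  by apply: SmoothAdd; exact: SmoothMul.
Qed.

Lemma smooth_ring_smooth f : smooth_ring f -> smooth f.
Proof.
move=> rf s; suff : smooth_ring (partials s f) by exact: smooth_ring_C1.
by elim: s => //= j s; exact: smooth_ring_partial.
Qed.

Lemma partials_cst s (k : R) : exists k', partials s (cst k) = cst k'.
Proof.
elim: s => [|j s [k' /= ->]]; first by exists k.
by exists 0; exact: partial_cst.
Qed.

Lemma smooth_cst (k : R) : smooth (cst k).
Proof.
move=> s; have [k' ->] := partials_cst s k.
by split; [move=> x; exact: cst_continuous | move=> x j; exact: derivable_cst].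
Qed.

Lemma smoothD f g : smooth f -> smooth g -> smooth (f + g).
Proof. by move=> sf sg; apply/smooth_ring_smooth/SmoothAdd; exact: SmoothGen. Qed.

Lemma smoothM f g : smooth f -> smooth g -> smooth (f * g).
Proof. by move=> sf sg; apply/smooth_ring_smooth/SmoothMul; exact: SmoothGen. Qed.

Lemma smoothZ (k : R) f : smooth f -> smooth (k *: f).
Proof. by move=> sf; exact: (smoothM (smooth_cst k) sf). Qed.

Lemma smoothN f : smooth f -> smooth (- f).
Proof. by rewrite -scaleN1r; exact: smoothZ. Qed.

Lemma smoothB f g : smooth f -> smooth g -> smooth (f - g).
Proof. by move=> sf /smoothN; exact: smoothD. Qed.

Lemma smooth_sum (I : Type) (r : seq I) (F : I -> E -> R) :
  (forall i, smooth (F i)) -> smooth (\sum_(i <- r) F i).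
Proof.
move=> sF; elim/big_ind: _ => [|f g|i _].
- exact: (smooth_cst 0).
- exact: smoothD.
- exact: sF.
Qed.

End Calculus.

(** Reduces smoothness to that of the constituents, following the shape of the
    function; plain unification would unfold the partial derivatives. *)
Ltac smooth_shape :=
  lazymatch goal with
  | H : smooth ?f |- smooth ?f => exact H
  | |- smooth (partial _ _) => apply: smooth_partial; smooth_shape
  | |- smooth (partials _ _) => apply: smooth_partials; smooth_shape
  | |- smooth (_ + _) => apply: smoothD; smooth_shape
  | |- smooth (- _) => apply: smoothN; smooth_shape
  | |- smooth (_ * _) => apply: smoothM; smooth_shape
  | |- smooth (_ *: _) => apply: smoothZ; smooth_shape
  | |- smooth (cst _) => exact: smooth_cst
  | |- smooth (\sum_(_ <- _) _) => apply: smooth_sum => ?; smooth_shape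
  | |- forall i, smooth _ => move=> ?; smooth_shape
  | H : forall i, smooth (?F i) |- smooth (?F ?j) => exact (H j)
  | H : forall i, smooth (?F i ?g) |- smooth (?F ?j ?g) => exact (H j)
  end.

Section LinearityOfDerivatives.
Context {R : realType}.
Local Notation E := 'rV[R]_3.
Implicit Types (f g : E -> R).

Local Opaque partial.
Lemma partialN j f : smooth f -> partial j (- f) = - partial j f.
Proof. by move=> sf; rewrite -scaleN1r partialZ ?scaleN1r; try smooth_shape. Qed.

Lemma partialB j f g : smooth f -> smooth g ->
  partial j (f - g) = partial j f - partial j g.
Proof. by move=> sf sg; rewrite partialD ?partialN; try smooth_shape. Qed.

Lemma partial_sum j (I : Type) (r : seq I) (F : I -> E -> R) :
  (forall i, smooth (F i)) ->
  partial j (\sum_(i <- r) F i) = \sum_(i <- r) partial j (F i).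
Proof.
move=> sF; elim: r => [|i r IH]; first by rewrite !big_nil; exact: partial_cst.
by rewrite !big_cons partialD ?IH; try smooth_shape.
Qed.

Lemma partialsZ s (k : R) f : smooth f -> partials s (k *: f) = k *: partials s f.
Proof.
move=> sf; elim: s => [//|j s IH] /=.
by rewrite IH partialZ; try smooth_shape.
Qed.

Lemma laplacianE f : laplacian f = \sum_(j < 3) partial j (partial j f).
Proof. by apply/funext => x; rewrite /laplacian fct_sumE. Qed.

Lemma partials_laplacian s f : smooth f ->
  partials s (laplacian f) = laplacian (partials s f).
Proof.
move=> sf; elim: s => [//|j s IH] /=; rewrite IH !laplacianE partial_sum; try smooth_shape.
apply: eq_bigr => k _; have sp := smooth_partials s sf.
by rewrite (partialC j k (smooth_partial k sp)) (partialC j k sp).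
Qed.

Lemma laplacianD f g : smooth f -> smooth g ->
  laplacian (f + g) = laplacian f + laplacian g.
Proof.
move=> sf sg; rewrite !laplacianE -big_split; apply: eq_bigr => j _ /=.
by rewrite !partialD; try smooth_shape.
Qed.

Lemma laplacianZ (k : R) f : smooth f -> laplacian (k *: f) = k *: laplacian f.
Proof.
move=> sf; rewrite !laplacianE scaler_sumr; apply: eq_bigr => j _.
by rewrite !partialZ; try smooth_shape.
Qed.

Lemma laplacian_sum (I : Type) (r : seq I) (F : I -> E -> R) :
  (forall i, smooth (F i)) ->
  laplacian (\sum_(i <- r) F i) = \sum_(i <- r) laplacian (F i).
Proof.
move=> sF; rewrite laplacianE.
under [RHS]eq_bigr do rewrite laplacianE.
rewrite exchange_big; apply: eq_bigr => j _.
by rewrite !partial_sum; try smooth_shape.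
Qed.

Lemma smooth_iter n j f : smooth f -> smooth (iter n (partial j) f).
Proof. by move=> sf; elim: n => [|n IH]; [exact: sf | exact: smooth_partial]. Qed.

Local Transparent partial.
Lemma partial_periodic j f : periodic2pi f -> periodic2pi (partial j f).
Proof.
move=> pf x k; rewrite /partial /derive pf.
have e : (fun h : R => h^-1 *:
    ((f \o shift (x + (2 * pi) *: basis_vec k)) (h *: basis_vec j) - f x)) =
    (fun h : R => h^-1 *: ((f \o shift x) (h *: basis_vec j) - f x)).
  by apply/funext => h /=; rewrite addrA pf.
by rewrite e.
Qed.

Lemma partials_periodic s f : periodic2pi f -> periodic2pi (partials s f).
Proof. by move=> pf; elim: s => //= j s; exact: partial_periodic. Qed.

End LinearityOfDerivatives.

(** * Polynomial differential operators *)

Section Digits.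
Local Open Scope nat_scope.

Lemma digits_inj (B a b c a' b' c' : nat) :
  a < B -> b < B -> a' < B -> b' < B ->
  a + (b + c * B) * B = a' + (b' + c' * B) * B -> [/\ a = a', b = b' & c = c'].
Proof.
move=> aB bB a'B b'B e.
have B0 : 0 < B by apply: leq_ltn_trans aB.
have ea : a = a' by have := congr1 (modn^~ B) e; rewrite ![_ + _ * B]addnC !modnMDl !modn_small.
move: e; rewrite ea => /addnI /eqP; rewrite eqn_pmul2r // => /eqP e.
have eb : b = b' by have := congr1 (modn^~ B) e; rewrite ![_ + _ * B]addnC !modnMDl !modn_small.
by move: e; rewrite eb => /addnI /eqP; rewrite eqn_pmul2r // => /eqP.
Qed.
End Digits.

Section PolynomialOperators.
Context {R : realType}.
Local Notation E := 'rV[R]_3.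
Local Notation mono := (mpoly.multinom 3).
Local Notation mpol := (mpoly.mpoly 3 R).
Implicit Types (f g : E -> R) (p q : mpol) (phi : mono -> R).

Lemma poly_vanishing (q : {poly R}) : (forall t, q.[t] = 0) -> q = 0.
Proof.
move=> q0; apply/eqP/negPn/negP => qn0.
pose s := [seq (i%:R : R) | i <- iota 0 (size q)].
have := max_poly_roots qn0 (_ : all (root q) s) (_ : uniq s).
rewrite size_map size_iota ltnn => H.
suff : false by []; apply: H.
- by apply/allP => t _; apply/rootP.
- by rewrite map_inj_uniq ?iota_uniq // => i j /eqP; rewrite eqr_nat => /eqP.
Qed.

(** Substituting t, t^B, t^(B^2) for the variables, with B larger than all the
    exponents (Kronecker's trick), yields a polynomial in t whose coefficients
    are those of p. *)
Lemma meval_eq0 p : (forall x, mpoly.meval x p = 0) -> p = 0.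
Proof.
move=> p0.
pose B := (\max_(m <- mpoly.msupp p) mpoly.mdeg m).+1.
pose o0 : 'I_3 := inord 0; pose o1 : 'I_3 := inord 1; pose o2 : 'I_3 := inord 2.
pose dg (m : mono) (i : 'I_3) := mpoly.fun_of_multinom m i.
pose code (m : mono) := (dg m o0 + (dg m o1 + dg m o2 * B) * B)%N.
have dgB m i : m \in mpoly.msupp p -> (dg m i < B)%N.
  move=> mp; rewrite ltnS; apply: (@leq_trans (mpoly.mdeg m)).
    by rewrite mpoly.mdegE (bigD1 i) //= leq_addr.
  by rewrite (big_rem m) //= leq_maxl.
have code_inj : {in mpoly.msupp p &, injective code}.
  move=> m m' mp mp' /digits_inj[]; try exact: dgB.
  move=> e0 e1 e2; apply/mpoly.mnmP => i.
  have fold k (hk : (k < 3)%N) : (Ordinal hk : 'I_3) = inord k.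
    by apply/val_inj; rewrite /= inordK.
  by case: i => [[|[|[|//]]] hi]; rewrite fold.
pose q : {poly R} := \sum_(m <- mpoly.msupp p) mpoly.mcoeff m p *: 'X^(code m).
have q0 : q = 0.
  apply: poly_vanishing => t.
  rewrite -[RHS](p0 (fun i : 'I_3 => t ^+ (B ^ i))) mpoly.mevalE horner_sum.
  apply: eq_bigr => m _; rewrite hornerZ hornerXn; congr (_ * _).
  rewrite !big_ord_recl big_ord0 /= mulr1 -!exprM -!exprD; congr (_ ^+ _).
  rewrite /code expn1 expn0 mul1n -[in RHS]mulnn.
  have -> : o0 = ord0 by apply/val_inj; rewrite /= inordK.
  have -> : o1 = lift ord0 ord0 by apply/val_inj; rewrite /= inordK.
  have -> : o2 = lift ord0 (lift ord0 ord0) by apply/val_inj; rewrite /= inordK.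
  rewrite /dg; nia.
apply/eqP/negPn/negP => pn0.
have [m0 m0p] : exists m0, m0 \in mpoly.msupp p.
  case e : (mpoly.msupp p) => [|m0 s]; last by exists m0; rewrite mem_head.
  by move/eqP: e; rewrite mpoly.msupp_eq0 (negbTE pn0).
have := congr1 (fun r : {poly R} => r`_(code m0)) q0.
rewrite coef0 coef_sum (big_rem m0) //= coefZ coefXn eqxx mulr1 big1_seq.
  rewrite addr0 => /eqP; rewrite mpoly.mcoeff_eq0; exact/negP/negPn.
move=> m; rewrite mem_rem_uniq ?mpoly.msupp_uniq //= => /andP[mm0 mp].
rewrite coefZ coefXn; case: eqP => [e|_]; last by rewrite mulr0.
by move/eqP: mm0 => []; apply: code_inj.
Qed.

(** The linear form on polynomials with the values phi on the monomials. The
    operator p(nabla), evaluated at a function and a point, is of this kind. *)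
Definition mono_sum p phi : R :=
  \sum_(m <- mpoly.msupp p) mpoly.mcoeff m p * phi m.

Lemma mono_sum_widen p phi (s : seq mono) : uniq s ->
  {subset mpoly.msupp p <= s} -> mono_sum p phi = \sum_(m <- s) mpoly.mcoeff m p * phi m.
Proof.
move=> us sub; rewrite /mono_sum [RHS](bigID (mem (mpoly.msupp p))) /=.
rewrite [X in _ + X]big1 ?addr0 => [|m]; last first.
  by move/mpoly.memN_msupp_eq0 ->; rewrite mul0r.
rewrite -[RHS]big_filter; apply: perm_big.
rewrite uniq_perm ?filter_uniq ?mpoly.msupp_uniq // => m.
by rewrite mem_filter; case: (boolP (m \in mpoly.msupp p)) => //= /sub ->.
Qed.

Lemma mono_sumD p q phi : mono_sum (p + q) phi = mono_sum p phi + mono_sum q phi.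
Proof.
pose s := undup (mpoly.msupp p ++ mpoly.msupp q ++ mpoly.msupp (p + q)).
have us : uniq s by exact: undup_uniq.
have sub r : {subset mpoly.msupp r <=
    mpoly.msupp p ++ mpoly.msupp q ++ mpoly.msupp (p + q)} ->
    {subset mpoly.msupp r <= s}.
  by move=> H m /H; rewrite mem_undup.
rewrite !(@mono_sum_widen _ phi s) //.
- by rewrite -big_split; apply: eq_bigr => m _; rewrite mpoly.mcoeffD mulrDl.
- by apply: sub => m; rewrite !mem_cat => ->; rewrite orbT.
- by apply: sub => m; rewrite !mem_cat => ->.
- by apply: sub => m; rewrite !mem_cat => ->; rewrite !orbT.
Qed.

Lemma mono_sum0 phi : mono_sum 0 phi = 0.
Proof. by rewrite /mono_sum mpoly.msupp0 big_nil. Qed.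

Lemma mono_sumXM (j : 'I_3) p phi :
  mono_sum (mpoly.mpolyX R (mpoly.mnm1 j) * p) phi
  = mono_sum p (fun m => phi (mpoly.mnm_add (mpoly.mnm1 j) m)).
Proof.
rewrite mulrC /mono_sum (perm_big _ (mpoly.msuppMX p (mpoly.mnm1 j))) big_map.
by apply: eq_bigr => m _; rewrite mpoly.mcoeffMX.
Qed.

(** Admissibility speaks of values; over the infinite field R it is an identity
    between polynomials, which operators can inherit. *)
Lemma admissible_sum0 (p : 'I_3 -> mpol) : admissible p ->
  \sum_j mpoly.mpolyX R (mpoly.mnm1 j) * p j = 0.
Proof.
move=> ap; apply: meval_eq0 => x; rewrite -[RHS](ap x) raddf_sum /=.
by apply: eq_bigr => j _; rewrite mpoly.mevalM mpoly.mevalXU.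
Qed.

Lemma mpartialE (m : mono) f : mpartial m f =
  partials (flatten [seq nseq (mpoly.fun_of_multinom m j) j | j <- enum 'I_3]) f.
Proof.
rewrite /mpartial; elim: (enum 'I_3) => //= j s ->.
by rewrite partials_cat; elim: (mpoly.fun_of_multinom m j) => //= k ->.
Qed.

Lemma poly_opE p f : poly_op p f =
  \sum_(m <- mpoly.msupp p) mpoly.mcoeff m p *: mpartial m f.
Proof. by apply/funext => x; rewrite /poly_op fct_sumE. Qed.

Lemma smooth_mpartial m f : smooth f -> smooth (mpartial m f).
Proof. by rewrite mpartialE; exact: smooth_partials. Qed.

Lemma smooth_poly_op p f : smooth f -> smooth (poly_op p f).
Proof.
move=> sf; rewrite poly_opE; apply: smooth_sum => m.
exact/smoothZ/smooth_mpartial.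
Qed.

Local Opaque partial.

Lemma mpartial_partial m j f : smooth f ->
  mpartial m (partial j f) = partial j (mpartial m f).
Proof. by rewrite !mpartialE; exact: partials_partial. Qed.

Lemma poly_op_partial p j f : smooth f ->
  poly_op p (partial j f) = partial j (poly_op p f).
Proof.
move=> sf; rewrite !poly_opE partial_sum; last first.
  by move=> m; exact/smoothZ/smooth_mpartial.
apply: eq_bigr => m _; rewrite mpartial_partial // partialZ //.
exact: smooth_mpartial.
Qed.

(** [mpartial] applies the derivatives in a fixed order; the additional one is
    moved to its place by the symmetry of mixed derivatives. *)
Lemma mpartialU j m f : smooth f ->
  mpartial (mpoly.mnm_add (mpoly.mnm1 j) m) f = partial j (mpartial m f).
Proof.
move=> sf; rewrite /mpartial.
have: j \in enum 'I_3 by rewrite mem_enum.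
have: uniq (enum 'I_3) by exact: enum_uniq.
elim: (enum 'I_3) => [//|k s IH] /= /andP[ks us].
rewrite in_cons mpoly.mnmDE mpoly.mnm1E.
pose g m' := foldr (fun j0 : 'I_3 => iter (mpoly.fun_of_multinom m' j0) (partial j0)) f s.
rewrite -/(g m) -/(g (mpoly.mnm_add (mpoly.mnm1 j) m)) in IH *.
have sg : smooth (g m).
  by rewrite /g; elim: (s) => [|l r IHr]; [exact: sf | exact: smooth_iter].
case: eqVneq => [->|jk] /=.
  move=> _; congr (partial k _); congr (iter _ _ _).
  apply/esym; rewrite /g.
  elim: (s) ks => [//|l r IHr]; rewrite in_cons negb_or => /andP[kl kr] /=.
  by rewrite -IHr // mpoly.mnmDE mpoly.mnm1E (negbTE kl).
move=> js; rewrite ?add0n (IH us js).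
elim: (mpoly.fun_of_multinom m k) => [//|n IHn] /=.
rewrite IHn; apply: partialC.
exact: smooth_iter.
Qed.

Lemma partial_poly_op p j f : smooth f ->
  partial j (poly_op p f) = poly_op (mpoly.mpolyX R (mpoly.mnm1 j) * p) f.
Proof.
move=> sf; rewrite -poly_op_partial //; apply/funext => x.
apply: etrans (esym (mono_sumXM j p (fun m => mpartial m f x))).
by apply: eq_bigr => m _; rewrite mpartial_partial // mpartialU.
Qed.

(** The divergence of p(nabla) f is q(nabla) f for the polynomial
    q = x_1 p_1 + x_2 p_2 + x_3 p_3, which is 0. *)
Lemma admissible_divergence (p : 'I_3 -> mpol) f : admissible p -> smooth f ->
  \sum_j partial j (poly_op (p j) f) = 0.
Proof.
move=> ap sf; apply/funext => x; rewrite fct_sumE.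
have -> : \sum_j partial j (poly_op (p j) f) x =
    mono_sum (\sum_j mpoly.mpolyX R (mpoly.mnm1 j) * p j) (fun m => mpartial m f x).
  rewrite (big_morph (mono_sum^~ _) (fun q r => mono_sumD q r _) (mono_sum0 _)).
  by apply: eq_bigr => j _; rewrite partial_poly_op.
by rewrite admissible_sum0 // mono_sum0.
Qed.

Lemma laplacian_poly_op p f : smooth f ->
  laplacian (poly_op p f) = poly_op p (laplacian f).
Proof.
move=> sf; rewrite !poly_opE laplacian_sum => [|m]; last first.
  exact/smoothZ/smooth_mpartial.
apply: eq_bigr => m _; rewrite laplacianZ; last exact: smooth_mpartial.
by rewrite mpartialE -partials_laplacian // -mpartialE.
Qed.

Lemma poly_op_periodic p f : periodic2pi f -> periodic2pi (poly_op p f).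
Proof.
move=> pf x j; apply: eq_bigr => m _.
by rewrite !mpartialE partials_periodic.
Qed.

End PolynomialOperators.

(** * Beltrami fields *)

Section Beltrami.
Context {R : realType}.
Local Notation E := 'rV[R]_3.
Implicit Types (f g : E -> R) (a U : 'I_3 -> E -> R) (l : R) (j k : 'I_3).

Lemma cyclic_index j :
  [/\ j + 1 + 1 = j + 2, j + 1 + 2 = j, j + 2 + 1 = j & j + 2 + 2 = j + 1].
Proof. by case: j => [[|[|[|//]]] hj]; split; apply/val_inj. Qed.

Lemma sum_cyclic (V : nmodType) (F : 'I_3 -> V) j :
  \sum_k F k = F j + F (j + 1) + F (j + 2).
Proof.
rewrite (bigD1 j) //= (bigD1 (j + 1)) /=; last first.
  by case: j => [[|[|[|//]]] hj].
rewrite (bigD1 (j + 2)) /=; last by case: j => [[|[|[|//]]] hj].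
rewrite big1 ?addr0 ?addrA // => k.
by case: j k => [[|[|[|//]]] hj] [[|[|[|//]]] hk].
Qed.

Definition curl a j : E -> R :=
  partial (j + 1) (a (j + 2)) - partial (j + 2) (a (j + 1)).

(** Solenoidal eigenfields of the curl, here with eigenvalue - l. *)
Record beltrami l U : Prop := Beltrami {
  beltrami_smooth : forall j, smooth (U j);
  beltrami_periodic : forall j, periodic2pi (U j);
  beltrami_div : \sum_j partial j (U j) = 0;
  beltrami_laplacian : forall j, laplacian (U j) = - l ^+ 2 *: U j;
  beltrami_curl : forall j, curl U j = - l *: U j }.

Lemma curlE a j :
  curl a j = partial (j + 1) (a (j + 2)) - partial (j + 2) (a (j + 1)).
Proof. by []. Qed.

Local Opaque partial.

Lemma smooth_curl a j : (forall k, smooth (a k)) -> smooth (curl a j).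
Proof. by move=> sa; rewrite /curl; smooth_shape. Qed.

Lemma div_curl a : (forall k, smooth (a k)) -> \sum_j partial j (curl a j) = 0.
Proof.
move=> sa; rewrite (sum_cyclic _ 0) /curl !partialB; try smooth_shape.
have [-> -> -> ->] := cyclic_index 0.
rewrite (partialC 0 (0 + 1) (sa (0 + 2))) (partialC 0 (0 + 2) (sa (0 + 1))).
rewrite (partialC (0 + 1) (0 + 2) (sa 0)).
have cancel (A B C : E -> R) : A - B + (C - A) + (B - C) = 0.
  have H (r s t : R) : r - s + (t - r) + (s - t) = 0 by ring.
  by apply/funext => x; exact: H.
exact: cancel.
Qed.

(** curl curl = grad div - Laplacian, here for a solenoidal field *)
Lemma curl_curl a j : (forall k, smooth (a k)) -> \sum_k partial k (a k) = 0 ->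
  curl (curl a) j = - laplacian (a j).
Proof.
move=> sa div0; rewrite /curl; have [-> -> -> ->] := cyclic_index j.
rewrite !partialB; try smooth_shape.
have := congr1 (partial j) div0.
rewrite (sum_cyclic _ j) !partialD; try smooth_shape.
rewrite (partial_cst j 0) laplacianE (sum_cyclic _ j).
rewrite (partialC j (j + 1) (sa _)) (partialC j (j + 2) (sa _)) => e.
have cancel (A B C D F : E -> R) :
    A + B + C = 0 -> B - D - (F - C) = - (A + D + F).
  have H (r s t d f : R) : r + s + t = 0 -> s - d - (f - t) = - (r + d + f).
    by move=> e0; lra.
  by move=> e0; apply/funext => x; exact: H (congr1 (fun f => f x) e0).
exact: cancel e.
Qed.

Lemma laplacian_curl a j l : (forall k, smooth (a k)) ->
  (forall k, laplacian (a k) = - l ^+ 2 *: a k) ->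
  laplacian (curl a j) = - l ^+ 2 *: curl a j.
Proof.
move=> sa ea.
have pl k i : laplacian (partial k (a i)) = - l ^+ 2 *: partial k (a i).
  rewrite -[partial k (a i)]/(partials [:: k] (a i)) -partials_laplacian ?ea //=.
  by rewrite partialZ.
rewrite /curl -scaleN1r laplacianD ?laplacianZ ?pl; try smooth_shape.
by rewrite scalerDr !scalerA mulrC.
Qed.

Local Opaque curl.

(** The field l a - curl a is an eigenfield of the curl: applying the curl
    gives l curl a - curl curl a = l curl a - l^2 a. *)
Lemma beltrami_potential l a : (forall j, smooth (a j)) ->
  (forall j, periodic2pi (a j)) -> \sum_j partial j (a j) = 0 ->
  (forall j, laplacian (a j) = - l ^+ 2 *: a j) ->
  beltrami l (fun j => l *: a j - curl a j).
Proof.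
move=> sa pa diva ea.
have sc j : smooth (curl a j) by exact: smooth_curl.
split=> [j|j x k||j|j].
- smooth_shape.
- rewrite !curlE !fctE !pa !(partial_periodic _ (pa _)); reflexivity.
- transitivity (l *: (\sum_j partial j (a j)) - \sum_j partial j (curl a j)).
    rewrite scaler_sumr -sumrB; apply: eq_bigr => j _.
    by rewrite partialB ?partialZ; try smooth_shape.
  by rewrite diva div_curl // scaler0 subrr.
- have lc := laplacian_curl j sa ea; have sj := sc j; rewrite -scaleN1r.
  rewrite laplacianD ?laplacianZ ?lc ?ea; try smooth_shape.
  have H (m : R) (f g : E -> R) :
      l *: (m *: f) + -1 *: (m *: g) = m *: (l *: f + -1 *: g).
    by rewrite scalerDr !scalerA mulrC [-1 * m]mulrC.
  exact: H.
- transitivity (l *: curl a j - curl (curl a) j).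
    rewrite !curlE !partialB ?partialZ; try smooth_shape.
    have H (p q r s : R) : l * p - q - (l * r - s) = l * (p - r) - (q - s) by ring.
    by apply/funext => x; exact: H.
  rewrite curl_curl // ea; have H (p q : R) :
      l * p - - (- l ^+ 2 * q) = - l * (l * q - p) by ring.
  by apply/funext => x; exact: H.
Qed.

(** In (U . nabla) U = nabla |U|^2 / 2 - U x curl U the last term vanishes, the
    curl of U being parallel to U. *)
Lemma beltrami_advection l U j x : beltrami l U ->
  \sum_k U k x * partial k (U j) x = \sum_k U k x * partial j (U k) x.
Proof.
move=> bU; rewrite !(sum_cyclic _ j) -!addrA; congr (_ + _).
have := congr1 (fun f => f x) (beltrami_curl bU (j + 1)).
have := congr1 (fun f => f x) (beltrami_curl bU (j + 2)).
rewrite !curlE; have [-> -> -> ->] := cyclic_index j; rewrite !fctE => e2 e1.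
have {}e1 : partial (j + 2) (U j) x = partial j (U (j + 2)) x - l * U (j + 1) x.
  have H (p q r : R) : p - q = - l * r -> p = q - l * r by move=> e; clear -e; lra.
  exact: H e1.
have {}e2 : partial (j + 1) (U j) x = partial j (U (j + 1)) x + l * U (j + 2) x.
  have H (p q r : R) : q - p = - l * r -> p = q + l * r by move=> e; clear -e; lra.
  exact: H e2.
by rewrite e1 e2; ring.
Qed.

Lemma initial_data_beltrami (lam : nat -> R) (u : E -> E) :
  initial_data_B lam u -> exists l, beltrami l (ucomp^~ u).
Proof.
case=> p ap [n _] [psi [sp pp ep] eu]; exists (lam n).
pose a j := poly_op (p j) psi.
have -> : ucomp^~ u = (fun j => lam n *: a j - curl a j).
  apply/funext => j; apply/funext => x.
  rewrite /ucomp eu /op_apply /op_cross_nabla !mxE curlE !fctE -!poly_op_partial //.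
  by rewrite opprB.
apply: beltrami_potential => [j|j||j].
- exact: smooth_poly_op.
- exact: poly_op_periodic.
- exact: admissible_divergence.
- rewrite /a laplacian_poly_op //.
  have -> : laplacian psi = - lam n ^+ 2 *: psi.
    by apply/funext => x; rewrite -[LHS]opprK ep !fctE -mulNr.
  rewrite !poly_opE scaler_sumr; apply: eq_bigr => m _.
  by rewrite !mpartialE partialsZ // !scalerA mulrC.
Qed.

End Beltrami.

(** * The decaying flow of a Beltrami field *)

Section ExplicitSolution.
Context {R : realType}.
Local Notation E := 'rV[R]_3.
Implicit Types (f g : E -> R) (a nu l t : R).

Definition decaying a f : R -> E -> R := fun t x => expR (- a * t) * f x.

Lemma continuous_exp_time a : continuous (fun z : R * E => expR (- a * z.1)).
Proof.
move=> z; apply: (@continuous_comp _ _ _ (fun z : R * E => - a * z.1) expR).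
  by apply: continuousM; [exact: cst_continuous | exact: cvg_fst].
exact: continuous_expR.
Qed.

Lemma continuous_decaying a f : continuous f ->
  continuous (fun z : R * E => decaying a f z.1 z.2).
Proof.
move=> cf z; apply: (@continuousM _ _ (fun z => expR (- a * z.1)) (f \o snd)).
  exact: continuous_exp_time.
by apply: continuous_comp; [exact: cvg_snd | exact: cf].
Qed.

Lemma is_derive_decaying a f t (x : E) :
  is_derive t 1 (fun s => decaying a f s x) (decaying a (- a *: f) t x).
Proof.
have d1 : is_derive t (1 : R) (- a *: id : R -> R) (- a * 1).
  exact: is_deriveZ.
have d2 := is_derive1_comp (is_derive_expR _) d1.
have d3 := is_deriveZ (f x) d2.
have -> : (fun s => decaying a f s x) = (f x \*: (expR \o (- a *: id))).
  by apply/funext => s; exact: mulrC.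
apply: is_derive_eq d3 _; rewrite /decaying.
have H (p q : R) : q * (p * (- a * 1)) = p * (- a * q) by ring.
exact: H.
Qed.

Lemma dt_decaying a f : dt (decaying a f) = decaying a (- a *: f).
Proof.
apply/funext => t; apply/funext => x.
by rewrite /dt derive1E; have /@derive_val -> := is_derive_decaying a f t x.
Qed.

Local Opaque partial.

Lemma partial_decaying a f j t : smooth f ->
  partial j (decaying a f t) = decaying a (partial j f) t.
Proof. by move=> sf; rewrite -[LHS]/(partial j (expR (- a * t) *: f)) partialZ. Qed.

Lemma stpartials_decaying a f s : smooth f ->
  exists2 g, smooth g & stpartials s (decaying a f) = decaying a g.
Proof.
move=> sf; elim: s => [|o s [g sg /= ->]]; first by exists f.
case: o => [j|] /=.
  exists (partial j g); first exact: smooth_partial.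
  by apply/funext => t; exact: partial_decaying.
by exists (- a *: g); [exact: smoothZ | exact: dt_decaying].
Qed.

Lemma smooth_half_space_decaying a f :
  smooth f -> smooth_half_space (decaying a f).
Proof.
move=> sf; split.
  apply: continuous_subspaceT; apply: continuous_decaying.
  exact: smooth_continuous.
move=> s; have [g sg ->] := stpartials_decaying a s sf; split.
  move=> [j|] t x _ /=; last by have [] := is_derive_decaying a g t x.
  by apply: derivableZ; exact: smooth_derivable.
exists (decaying a g) => //; apply: continuous_subspaceT.
by apply: continuous_decaying; exact: smooth_continuous.
Qed.

Definition decaying_flow a (u0 : E -> E) : R -> E -> E := fun t x => expR (- a * t) *: u0 x.

Definition half_speed2 (u0 : E -> E) : E -> R := 2^-1 *: \sum_k ucomp k u0 * ucomp k u0.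

Lemma ucomp_decaying a (u0 : E -> E) j t :
  ucomp j (decaying_flow a u0 t) = decaying a (ucomp j u0) t.
Proof. by apply/funext => x; rewrite /ucomp mxE. Qed.

Lemma partial_half_speed2 (u0 : E -> E) j : (forall k, smooth (ucomp k u0)) ->
  partial j (half_speed2 u0) = \sum_k ucomp k u0 * partial j (ucomp k u0).
Proof.
move=> su; rewrite partialZ ?partial_sum; try smooth_shape.
rewrite scaler_sumr; apply: eq_bigr => k _; rewrite partialM; try smooth_shape.
have H (p q : R) : 2^-1 * (p * q + q * p) = q * p by field.
by apply/funext => x; exact: H.
Qed.

(** On a Beltrami field the advection term is the gradient of the kinetic
    energy, which the pressure absorbs; what remains is the heat equation, and
    the field is an eigenfunction of the Laplacian. *)
Lemma beltrami_NS_solution nu l (u0 : E -> E) : beltrami l (ucomp^~ u0) ->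
  NS_solution nu u0 (decaying_flow (nu * l ^+ 2) u0)
    (decaying (2 * (nu * l ^+ 2)) (- half_speed2 u0)).
Proof.
move=> bu; have su := beltrami_smooth bu.
have sh : smooth (- half_speed2 u0).
  by apply: smoothN; apply: smoothZ; apply: smooth_sum => k; smooth_shape.
set a := nu * l ^+ 2; split.
- split; last exact: smooth_half_space_decaying.
  move=> j; have -> : (fun t => ucomp j (decaying_flow a u0 t)) =
      decaying a (ucomp j u0) by apply/funext => t; exact: ucomp_decaying.
  exact: smooth_half_space_decaying.
- move=> t _; split=> x j.
    rewrite /decaying_flow; congr (_ *: _); apply/rowP => k.
    exact: (beltrami_periodic bu k x j).
  rewrite /decaying !fctE; congr (_ * - (_ * _)); rewrite !fct_sumE.
  by apply: eq_bigr => k _; rewrite !fctE (beltrami_periodic bu k x j).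
- move=> t x j _; rewrite /NS_momentum.
  have -> : (fun t => ucomp j (decaying_flow a u0 t)) =
      decaying a (ucomp j u0) by apply/funext => s; exact: ucomp_decaying.
  rewrite dt_decaying (partial_decaying _ j t sh) partialN; last first.
    by apply: smoothZ; apply: smooth_sum => k; smooth_shape.
  rewrite partial_half_speed2 //.
  rewrite ucomp_decaying.
  have -> : laplacian (decaying a (ucomp j u0) t) x =
      expR (- a * t) * (- l ^+ 2 * ucomp j u0 x).
    have := congr1 (fun f => f x) (laplacianZ (expR (- a * t)) (su j)).
    by rewrite (beltrami_laplacian bu).
  have -> : \sum_k decaying_flow a u0 t x 0 k *
      partial k (decaying a (ucomp j u0) t) x =
      expR (- a * t) ^+ 2 * \sum_k ucomp k u0 x * partial k (ucomp j u0) x.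
    rewrite mulr_sumr; apply: eq_bigr => k _; rewrite partial_decaying //.
    by rewrite /decaying_flow /decaying mxE /ucomp; ring.
  rewrite (beltrami_advection j x bu) /decaying.
  have -> : (- \sum_k ucomp k u0 * partial j (ucomp k u0)) x =
      - \sum_k ucomp k u0 x * partial j (ucomp k u0) x.
    by rewrite !fctE fct_sumE.
  have -> : expR (- (2 * a) * t) = expR (- a * t) ^+ 2.
    by rewrite expr2 -expRD; congr expR; ring.
  rewrite {1}/a; have H (p q r s : R) :
      p * (- (nu * r) * q) - nu * (p * (- r * q)) + p ^+ 2 * s + p ^+ 2 * - s = 0.
    by clear; ring.
  exact: H.
- move=> t x _; rewrite /divergence.
  under eq_bigr => j _ do rewrite ucomp_decaying partial_decaying //.
  rewrite -mulr_sumr; have := congr1 (fun f => f x) (beltrami_div bu).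
  by rewrite /= fct_sumE => ->; rewrite mulr0.
- by move=> x; rewrite /decaying_flow mulr0 expR0 scale1r.
Qed.

End ExplicitSolution.

(** * Continuous periodic functions *)

Section PeriodicFunctions.
Context {R : realType}.
Local Notation E := 'rV[R]_3.
Implicit Types (f g : E -> R).

Lemma periodic_mul f j (k : int) (x : E) : periodic2pi f ->
  f (x + (2 * pi * k%:~R) *: basis_vec j) = f x.
Proof.
move=> pf.
have nat_shift (n : nat) y : f (y + (2 * pi * n%:R) *: basis_vec j) = f y.
  elim: n => [|n IH]; first by rewrite mulr0 scale0r addr0.
  by rewrite -[n.+1%:R]natr1 mulrDr mulr1 scalerDl addrA pf IH.
case: k => n; first exact: nat_shift.
rewrite NegzE mulrNz mulrN scaleNr.
by rewrite -(nat_shift n.+1 (x - _)) subrK.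
Qed.

Lemma periodic_lattice f (k : 'I_3 -> int) (x : E) : periodic2pi f ->
  f (x + \sum_j (2 * pi * (k j)%:~R) *: basis_vec j) = f x.
Proof.
move=> pf; elim: (index_enum _) => [|j s IH]; first by rewrite big_nil addr0.
by rewrite big_cons [X in x + X]addrC addrA periodic_mul.
Qed.

Lemma row_basis (a : 'I_3 -> R) : \sum_j a j *: basis_vec j = \row_j a j :> E.
Proof.
apply/rowP => i; rewrite summxE mxE (bigD1 i) //= big1 => [|j ji].
  by rewrite /basis_vec !mxE !eqxx mulr1 addr0.
by rewrite /basis_vec !mxE eqxx eq_sym (negbTE ji) mulr0.
Qed.

Definition cell : set E := [set x | forall j, `[0, 2 * pi]%classic (x ord0 j)].

Lemma compact_cell : compact cell.
Proof. by apply: (@rV_compact _ _ (fun=> _)) => j; exact: segment_compact. Qed.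

Lemma cell_reduction (x : E) :
  exists2 y, cell y & forall f, periodic2pi f -> f x = f y.
Proof.
have p0 : 0 < 2 * pi :> R by rewrite mulr_gt0 // pi_gt0.
pose k j := Num.floor (x 0 j / (2 * pi)).
exists (x - \sum_j (2 * pi * (k j)%:~R) *: basis_vec j) => [j|f pf].
  rewrite row_basis !mxE /= in_itv /=; have := floor_itv (x 0 j / (2 * pi)).
  rewrite -/(k j) => /andP[]; rewrite ler_pdivlMr // ltr_pdivrMr // => a b.
  rewrite intrD mulrDl mul1r in b.
  by apply/andP; split; lra.
by rewrite -[RHS](periodic_lattice k _ pf) subrK.
Qed.

Lemma periodic_bounded f : continuous f -> periodic2pi f ->
  exists M, forall x, `|f x| <= M.
Proof.
move=> cf pf; have cc : {within cell, continuous f} by exact: continuous_subspaceT.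
have [M [Mr HM]] := compact_bounded (continuous_compact cc compact_cell).
exists (M + 1) => x; have [y yc ->] := cell_reduction x => //.
by apply: HM; [rewrite ltrDl | exists y].
Qed.

(** Heine's theorem on [- T, T] x cell; periodicity extends it to all x. *)
Lemma uniformly_continuous_periodic (H : R -> E -> R) (T e : R) :
  continuous (fun z : R * E => H z.1 z.2) -> (forall t, periodic2pi (H t)) ->
  0 < e -> exists2 d, 0 < d &
    forall t t' x, `|t| <= T -> `|t - t'| < d -> `|H t x - H t' x| < e.
Proof.
move=> cH pH e0.
have cK := compact_setX (@segment_compact R (- T) T) compact_cell.
pose P (d : R) (z : R * E) :=
  forall t', `|z.1 - t'| < d -> `|H z.1 z.2 - H t' z.2| < e.
have near_P (z : R * E) : \forall w \near z & d \near 0^'+, P d w.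
  have e2 : 0 < e / 2 by rewrite divr_gt0.
  have /cvgrPdist_lt/(_ _ e2)/nbhs_ballP[r /= r0 Hr] := cH z.
  have r2 : 0 < r / 2 by rewrite divr_gt0.
  exists (ball z (r / 2), [set d | d < r / 2]) => /=.
    by split; [exact: nbhsx_ballx | exact: nbhs_right_lt].
  move=> [w d] [[/= b1 b2] dr] t' td.
  rewrite [e]splitr -(subrK (H z.1 z.2) (H w.1 w.2)) -addrA.
  apply: le_lt_trans (ler_normD _ _) _; rewrite ltrD //.
    rewrite distrC; apply: Hr; split; apply: le_ball b1 || apply: le_ball b2.
      by rewrite ler_pdivrMr // ler_pMr // ler1n.
    by rewrite ler_pdivrMr // ler_pMr // ler1n.
  apply: (Hr (t', w.2)); split => /=.
    rewrite /ball /= in b1 *; rewrite -(subrK w.1 z.1) -addrA.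
    apply: le_lt_trans (ler_normD _ _) _; rewrite [r]splitr ltrD //.
    exact: lt_trans td dr.
  by apply: le_ball b2; rewrite ler_pdivrMr // ler_pMr // ler1n.
have [d [d0 Hd]] := filter_ex (filterI (@nbhs_right_gt R 0)
  ((compact_near_coveringP _).1 cK R (0^'+) P _ (fun z _ => near_P z))).
exists d => // t t' x tT tt'.
have [y yc xy] := cell_reduction x; rewrite (xy _ (pH t)) (xy _ (pH t')).
apply: (Hd (t, y)) => //; split => //=.
by rewrite in_itv /= -ler_norml.
Qed.
End PeriodicFunctions.

(** * Means of translates *)

Section Mean.
Context {R : realType}.
Local Notation E := 'rV[R]_3.
Implicit Types (f g : E -> R).

(** Substitute for a nonpositive integral over the torus: arithmetic means of
    finitely many translates of f get uniformly below every positive number. The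
    property is stable under sums, holds for derivatives of periodic functions,
    and among the nonnegative continuous periodic functions holds for 0 only: an
    energy estimate asks no more of the integral. *)
Definition mean_nonpos f := forall e : R, 0 < e ->
  exists2 s : seq E, (0 < size s)%N &
    forall x, \sum_(h <- s) f (x + h) <= e * (size s)%:R.

Lemma mean_nonpos_le f g : (forall x, f x <= g x) ->
  mean_nonpos g -> mean_nonpos f.
Proof.
move=> fg mg e /mg[s s0 Hs]; exists s => // x; apply: le_trans (Hs x).
by apply: ler_sum => h _; exact: fg.
Qed.

(** A mean of translates of a mean of translates is again one, over all the sums
    of the shifts. *)
Lemma mean_nonposD f g :
  mean_nonpos f -> mean_nonpos g -> mean_nonpos (fun x => f x + g x).
Proof.
move=> mf mg e e0; have e2 : 0 < e / 2 by rewrite divr_gt0.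
have [s s0 Hs] := mf _ e2; have [t t0 Ht] := mg _ e2.
exists [seq h + k | h <- s, k <- t]; first by rewrite size_allpairs muln_gt0 s0.
move=> x; rewrite big_split /= !big_allpairs_dep size_allpairs [e]splitr mulrDl lerD //.
  rewrite exchange_big /=; apply: (@le_trans _ _ (\sum_(k <- t) (e / 2 * (size s)%:R))).
    apply: ler_sum => k _; apply: le_trans (Hs (x + k)).
    by apply: ler_sum => h _; rewrite addrAC addrA.
  by rewrite big_const_seq count_predT iter_addr_0 natrM mulrA [leRHS]mulr_natr.
apply: (@le_trans _ _ (\sum_(h <- s) (e / 2 * (size t)%:R))).
  apply: ler_sum => h _; apply: le_trans (Ht (x + h)).
  by apply: ler_sum => k _; rewrite addrA.
by rewrite big_const_seq count_predT iter_addr_0 mulnC natrM mulrA [leRHS]mulr_natr.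
Qed.

Lemma mean_nonposZ (c : R) f : 0 <= c -> mean_nonpos f ->
  mean_nonpos (fun x => c * f x).
Proof.
rewrite le_eqVlt => /predU1P[<-|c0] mf e e0.
  exists [:: 0] => // x; rewrite big_seq1 mul0r mulr1; exact: ltW.
have [s s0 Hs] := mf _ (divr_gt0 e0 c0); exists s => // x.
by rewrite -mulr_sumr mulrC -ler_pdivlMr // mulrAC; exact: Hs.
Qed.

Lemma mean_nonpos0 : mean_nonpos (fun=> 0).
Proof.
by move=> e e0; exists [:: 0] => // x; rewrite big_seq1 mulr1 ltW.
Qed.

Lemma mean_nonpos_sum (I : Type) (r : seq I) (F : I -> E -> R) :
  (forall i, mean_nonpos (F i)) -> mean_nonpos (fun x => \sum_(i <- r) F i x).
Proof.
move=> mF; elim: r => [|i r IH].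
  by apply: mean_nonpos_le mean_nonpos0 => x; rewrite big_nil.
by apply: mean_nonpos_le (mean_nonposD (mF i) IH) => x; rewrite big_cons.
Qed.

Lemma mean_nonpos_approx f :
  (forall d, 0 < d -> exists2 g, mean_nonpos g & forall x, f x <= g x + d) ->
  mean_nonpos f.
Proof.
move=> H e e0; have e2 : 0 < e / 2 by rewrite divr_gt0.
have [g mg fg] := H _ e2; have [s s0 Hs] := mg _ e2; exists s => // x.
apply: (@le_trans _ _ (\sum_(h <- s) (g (x + h) + e / 2))).
  by apply: ler_sum => h _; exact: fg.
rewrite big_split /= [e in leRHS]splitr mulrDl lerD //.
by rewrite big_const_seq count_predT iter_addr_0 mulr_natr.
Qed.

(** The mean over the shifts 0, h, ..., (N - 1) h telescopes to a quantity of
    order 1 / N. *)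
Lemma mean_nonpos_translate f (h : E) (M : R) : (forall x, `|f x| <= M) ->
  mean_nonpos (fun x => f (x + h) - f x).
Proof.
move=> fM e e0; pose N := (Num.bound (2 * M / e)).+1.
have M0 : 0 <= M by apply: le_trans (fM 0).
exists [seq h *+ k | k <- iota 0 N] => [|x]; first by rewrite size_map size_iota.
rewrite big_map size_map size_iota.
have -> : \sum_(k <- iota 0 N) (f (x + h *+ k + h) - f (x + h *+ k)) =
    f (x + h *+ N) - f x.
  elim: N => [|n IH]; first by rewrite big_nil mulr0n addr0 subrr.
  rewrite -addn1 iotaD big_cat IH big_seq1 /= addn1 mulrSr [in RHS]addrA.
  by rewrite [LHS]addrC subrKA.
apply: (@le_trans _ _ (2 * M)).
  apply: le_trans (ler_norm _) _; apply: le_trans (ler_normB _ _) _.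
  by rewrite mulr_natl mulr2n lerD.
rewrite -ler_pdivrMl // mulrC; apply/ltW/(lt_trans (archi_boundP _)).
  by rewrite divr_ge0 ?mulr_ge0 // ltW.
by rewrite ltr_nat.
Qed.

(** This is the substitute for the vanishing of the integral of a derivative:
    the derivative is a uniform limit of difference quotients. *)
Lemma mean_nonpos_partial j f : smooth f -> periodic2pi f ->
  mean_nonpos (partial j f).
Proof.
move=> sf pf; apply: mean_nonpos_approx => d d0.
have [M HM] := periodic_bounded (smooth_continuous sf) pf.
pose H (t : R) (x : E) := partial j f (x + t *: basis_vec j).
have cH : continuous (fun z : R * E => H z.1 z.2).
  move=> z; apply: continuous_comp; last exact/smooth_continuous/smooth_partial.
  apply: continuousD; first exact: cvg_snd.
  apply: (@continuous_comp _ _ _ (@fst R E) ( *:%R ^~ (basis_vec j))).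
    exact: cvg_fst.
  exact: scalel_continuous.
have pH t : periodic2pi (H t).
  by move=> x k; rewrite /H addrAC; exact: partial_periodic.
have [r r0 Hr] := uniformly_continuous_periodic 0 cH pH d0.
have r2 : 0 < r / 2 by rewrite divr_gt0.
exists (fun x => (r / 2)^-1 * (f (x + (r / 2) *: basis_vec j) - f x)).
  apply: mean_nonposZ; first by rewrite invr_ge0 ltW.
  exact: mean_nonpos_translate HM.
move=> x.
have [c cr ->] := mvt_line x (r / 2) (fun y => @smooth_derivable _ f y j sf).
rewrite mulKf ?gt_eqF // -lerBlDl -/(partial j f _).
have := Hr 0 c x; rewrite normr0 sub0r normrN lexx => /(_ isT).
rewrite /H scale0r addr0 => Hc; apply/ltW/(le_lt_trans (ler_norm _))/Hc.
by apply: le_lt_trans cr _; rewrite gtr0_norm // ltr_pdivrMr // ltr_pMr // ltr1n.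
Qed.

End Mean.

Section Faithful.
Context {R : realType}.
Local Notation E := 'rV[R]_3.
Implicit Types (f g : E -> R).

Definition grid_point (N : nat) (k : {ffun 'I_3 -> 'I_N.+1}) : E :=
  \row_j (2 * pi * (k j)%:R / N.+1%:R).

(** Each coordinate of y - x is rounded down to a multiple of the mesh size;
    Euclidean division of the multiple by the number of points in a period
    splits it into a period and a grid point. *)
Lemma grid_dense f (N : nat) (x y : E) : periodic2pi f ->
  exists k : {ffun 'I_3 -> 'I_N.+1}, exists2 z : E,
    f (x + grid_point k) = f z &
      forall j, `|y 0 j - z 0 j| <= 2 * pi / N.+1%:R.
Proof.
move=> pf; have p0 : 0 < 2 * pi :> R by rewrite mulr_gt0 // pi_gt0.
have N0 : 0 < N.+1%:R :> R by rewrite ltr0n.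
pose K j := Num.floor ((y 0 j - x 0 j) * N.+1%:R / (2 * pi)).
have Kr j : (`|(K j %% N.+1)%Z| < N.+1)%N.
  by rewrite -ltz_nat gez0_abs ?modz_ge0 // ltz_pmod.
exists [ffun j => Ordinal (Kr j)].
pose q j := (K j %/ N.+1)%Z.
set k := finfun _.
exists (x + grid_point k + \sum_j (2 * pi * (q j)%:~R) *: basis_vec j).
  by rewrite periodic_lattice.
move=> j; rewrite row_basis !mxE ffunE /=.
have eK : (`|(K j %% N.+1)%Z|%:R + (q j)%:~R * N.+1%:R = (K j)%:~R :> R).
  rewrite [in RHS](divz_eq (K j) N.+1) intrD intrM [RHS]addrC; congr (_ + _).
  by rewrite -{2}(gez0_abs (modz_ge0 (K j) _)).
have -> : y 0 j - (x 0 j + 2 * pi * `|(K j %% N.+1)%Z|%:R / N.+1%:R +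
    2 * pi * (q j)%:~R) = y 0 j - x 0 j - 2 * pi / N.+1%:R * (K j)%:~R.
  by rewrite -eK; field; rewrite gt_eqF.
have := floor_itv ((y 0 j - x 0 j) * N.+1%:R / (2 * pi)); rewrite -/(K j).
have -> : (y 0 j - x 0 j) * N.+1%:R / (2 * pi) =
    (y 0 j - x 0 j) / (2 * pi / N.+1%:R).
  by rewrite invf_div mulrA.
have b0 : 0 < 2 * pi / N.+1%:R :> R by rewrite divr_gt0.
rewrite ler_pdivlMr // ltr_pdivrMr // intrD => /andP[l1 l2].
have H (b c d : R) : c * b <= d -> d < (c + 1) * b -> `|d - b * c| <= b.
  by move=> h1 h2; rewrite ger0_norm; lra.
exact: H l1 l2.
Qed.

(** If f were at least c on a cube, the sum of its translates by a grid finer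
    than that cube would be at least c everywhere, which bounds all averages of
    translates of f from below. *)
Lemma mean_nonpos_eq0 f : continuous f -> periodic2pi f ->
  (forall x, 0 <= f x) -> mean_nonpos f -> forall x, f x = 0.
Proof.
move=> cf pf f0 mf y; apply/eqP/negPn/negP => fy.
have c0 : 0 < f y by rewrite lt_def fy f0.
have c2 : 0 < f y / 2 by rewrite divr_gt0.
have /cvgrPdist_lt/(_ _ c2)/nbhs_ballP[r /= r0 Hr] := cf y.
pose N := Num.bound (2 * pi / r).
have Nr : 2 * pi / N.+1%:R < r.
  rewrite ltr_pdivrMr ?ltr0n // -ltr_pdivrMl // [_^-1 * _]mulrC.
  apply: (lt_le_trans (archi_boundP _)); last by rewrite ler_nat.
  by rewrite divr_ge0 ?mulr_ge0 ?pi_ge0 // ltW.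
have lower x : f y / 2 <= \sum_(k : {ffun 'I_3 -> 'I_N.+1}) f (x + grid_point k).
  have [k [z fz yz]] := grid_dense N x y pf.
  rewrite (bigD1 k) //= fz; apply: (@le_trans _ _ (f z)); last first.
    by rewrite lerDl; apply: sumr_ge0 => l _; exact: f0.
  have : `|f y - f z| < f y / 2.
    apply: Hr; split=> // i j; rewrite (ord1 i) /ball /=.
    exact: le_lt_trans (yz j) Nr.
  by move/ltW/(le_trans (ler_norm _)); lra.
pose n : R := #|{ffun 'I_3 -> 'I_N.+1}|%:R.
have n0 : 0 < n by rewrite ltr0n; apply/card_gt0P; exists [ffun=> ord0].
have e0 : 0 < f y / 4 / n by rewrite !divr_gt0.
have [s s0 Hs] := mf _ e0.
have sR : 0 < (size s)%:R :> R by rewrite ltr0n.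
have : (size s)%:R * (f y / 2) <= n * (f y / 4 / n * (size s)%:R).
  apply: (@le_trans _ _ (\sum_(h <- s) \sum_(k : {ffun 'I_3 -> 'I_N.+1})
      f (0 + h + grid_point k))).
    rewrite mulr_natl -iter_addr_0 -(count_predT s) -big_const_seq.
    by apply: ler_sum => h _; exact: lower.
  rewrite exchange_big /= mulr_natl -[leRHS]sumr_const.
  apply: ler_sum => k _; apply: le_trans (Hs (grid_point k)).
  by apply: ler_sum => h _; rewrite add0r addrC.
rewrite [leRHS]mulrA [n * _]mulrC divfK ?gt_eqF // mulrC ler_pM2r //.
by move=> H; lra.
Qed.

End Faithful.

(** * The energy inequality at a fixed time *)

Section EnergyInequality.
Context {R : realType}.
Local Notation E := 'rV[R]_3.

(** Up to the divergence of the energy flux, the time derivative of |w|^2 is the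
    dissipation, which is nonpositive, minus the sum of 2 du_jk w_j w_k. Since
    M w_j^2 + 2 m w_j w_k + M w_k^2 >= 0 when |m| <= M, the latter is at most the
    sum of M w_j^2 + M w_k^2 over the nine pairs, that is 6 M |w|^2. *)
Lemma energy_balance (nu M q : R) (w a v u dq : 'I_3 -> R)
    (dw dv du ddw : 'I_3 -> 'I_3 -> R) : 0 <= nu ->
  (forall j, w j = v j - u j) ->
  (forall j k, `|du j k| <= M) ->
  (forall j k, dw j k = dv j k - du j k) ->
  \sum_k du k k = 0 -> \sum_k dv k k = 0 ->
  (forall j, a j = nu * (\sum_k ddw j k) - \sum_k v k * dv j k
                   + \sum_k u k * du j k - dq j) ->
  \sum_j 2 * w j * a j - 6 * M * (\sum_j w j * w j) <=
  \sum_k (2 * nu * (\sum_j (dw j k * dw j k + w j * ddw j k))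
          - (dv k k * (\sum_j w j * w j)
             + v k * (\sum_j (dw j k * w j + w j * dw j k)))
          - 2 * (dw k k * q + w k * dq k)).
Proof.
move=> nu0 ew dM edw divu divv ea; rewrite -subr_ge0.
set S := \sum_j w j * w j.
suff -> : \sum_k (2 * nu * (\sum_j (dw j k * dw j k + w j * ddw j k))
          - (dv k k * S + v k * (\sum_j (dw j k * w j + w j * dw j k)))
          - 2 * (dw k k * q + w k * dq k))
        - (\sum_j 2 * w j * a j - 6 * M * S) =
    \sum_j \sum_k (2 * nu * dw j k ^+ 2
       + (M * w j ^+ 2 + 2 * du j k * (w j * w k) + M * w k ^+ 2)).
  apply: sumr_ge0 => j _; apply: sumr_ge0 => k _; apply: addr_ge0.
    by apply: mulr_ge0; [exact: mulr_ge0 | exact: sqr_ge0].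
  have /ler_normlP[m1 m2] := dM j k.
  have H (m x y : R) : - m <= M -> m <= M ->
      0 <= M * x ^+ 2 + 2 * m * (x * y) + M * y ^+ 2.
    move=> h1 h2; have -> : M * x ^+ 2 + 2 * m * (x * y) + M * y ^+ 2 =
        ((M + m) * (x + y) ^+ 2 + (M - m) * (x - y) ^+ 2) / 2 by field.
    apply: divr_ge0 => //; apply: addr_ge0; apply: mulr_ge0;
      by rewrite ?sqr_ge0 //; lra.
  exact: H.
set B := (RHS).
(* the flux contributes the divergences of v and of w = v - u, which vanish *)
transitivity (B - S * \sum_k dv k k
    - 2 * q * (\sum_k dv k k - \sum_k du k k)).
  rewrite /B /S !big_ord_recl !big_ord0 /= !ea !edw !ew !big_ord_recl !big_ord0 /=.
  clear; ring.
by rewrite divu divv subr0 !mulr0 !subr0.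
Qed.

Local Opaque partial.

(** The difference w of two flows satisfies the inequality behind the stability
    of the energy: the mean of d|w|^2/dt - 6 M |w|^2 is nonpositive, because the
    mean of a divergence is. *)
Lemma energy_inequality (nu M : R) (u v : E -> E) (q : E -> R)
    (a : 'I_3 -> E -> R) (w := fun j => ucomp j v - ucomp j u) :
  0 <= nu ->
  (forall j, smooth (ucomp j u)) -> (forall j, smooth (ucomp j v)) -> smooth q ->
  periodic2pi u -> periodic2pi v -> periodic2pi q ->
  (forall x, divergence u x = 0) -> (forall x, divergence v x = 0) ->
  (forall j k x, `|partial k (ucomp j u) x| <= M) ->
  (forall j x, a j x = nu * laplacian (w j) x
     - \sum_k ucomp k v x * partial k (ucomp j v) x
     + \sum_k ucomp k u x * partial k (ucomp j u) x - partial j q x) ->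
  mean_nonpos (fun x => \sum_j 2 * w j x * a j x - 6 * M * \sum_j w j x * w j x).
Proof.
move=> nu0 su sv sq pu pv pq du0 dv0 dM ea.
have sw j : smooth (w j) by rewrite /w; smooth_shape.
have pw j : periodic2pi (w j).
  by move=> x k; rewrite /w !fctE /ucomp pu pv.
pose S : E -> R := \sum_j w j * w j.
have sS : smooth S by rewrite /S; smooth_shape.
have pS : periodic2pi S.
  by move=> x k; rewrite /S !fct_sumE; apply: eq_bigr => j _; rewrite !fctE pw.
pose K k : E -> R := \sum_j w j * partial k (w j).
have sK k : smooth (K k) by rewrite /K; smooth_shape.
have pK k : periodic2pi (K k).
  move=> x i; rewrite /K !fct_sumE; apply: eq_bigr => j _; rewrite !fctE pw.
  by rewrite (partial_periodic k (pw j)).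
(* the energy flux, whose divergence collects the terms without a sign *)
pose Phi k := (2 * nu) *: K k - ucomp k v * S - 2 *: (w k * q).
have sPhi k : smooth (Phi k) by rewrite /Phi; smooth_shape.
have pPhi k : periodic2pi (Phi k).
  by move=> x i; rewrite /Phi !fctE pK pS pw pq /ucomp pv.
apply: mean_nonpos_le (mean_nonpos_sum (index_enum _)
  (fun k => mean_nonpos_partial k (sPhi k) (pPhi k))) => x.
have dw j k : partial k (w j) = partial k (ucomp j v) - partial k (ucomp j u).
  by rewrite /w partialB; try smooth_shape.
have dPhi k : partial k (Phi k) = (2 * nu) *:
      (\sum_j (partial k (w j) * partial k (w j)
               + w j * partial k (partial k (w j))))
    - (partial k (ucomp k v) * S
       + ucomp k v * (\sum_j (partial k (w j) * w j + w j * partial k (w j))))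
    - 2 *: (partial k (w k) * q + w k * partial k q).
  have -> : \sum_j (partial k (w j) * partial k (w j) +
      w j * partial k (partial k (w j))) = partial k (K k).
    rewrite /K partial_sum; try smooth_shape.
    by apply: eq_bigr => j _; rewrite partialM; try smooth_shape.
  have -> : \sum_j (partial k (w j) * w j + w j * partial k (w j)) = partial k S.
    rewrite /S partial_sum; try smooth_shape.
    by apply: eq_bigr => j _; rewrite partialM; try smooth_shape.
  rewrite /Phi partialB; try smooth_shape.
  rewrite partialB; try smooth_shape.
  rewrite !partialZ; try smooth_shape.
  by rewrite (partialM k (sw k) sq) (partialM k (sv k) sS).
have := @energy_balance nu M (q x) (w^~ x) (a^~ x) (fun k => ucomp k v x)
  (fun k => ucomp k u x) (fun j => partial j q x)
  (fun j k => partial k (w j) x) (fun j k => partial k (ucomp j v) x)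
  (fun j k => partial k (ucomp j u) x) (fun j k => partial k (partial k (w j)) x)
  nu0 (fun j => erefl _) (fun j k => dM j k x) _ (du0 x) (dv0 x) (fun j => ea j x).
have dwx j k : partial k (w j) x = partial k (ucomp j v) x - partial k (ucomp j u) x.
  by rewrite dw.
move=> /(_ dwx) /le_trans; apply.
apply: ler_sum => k _; rewrite dPhi.
have eS : S x = \sum_j w j x * w j x by rewrite /S fct_sumE.
rewrite !fctE !fct_sumE eS; exact: lexx.
Qed.

End EnergyInequality.

(** * Evolution in time *)

Section Evolution.
Context {R : realType}.
Local Notation E := 'rV[R]_3.

Lemma continuous_pair {X U V : topologicalType} (f : X -> U) (g : X -> V) x :
  {for x, continuous f} -> {for x, continuous g} ->
  {for x, continuous (fun y => (f y, g y))}.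
Proof. by move=> cf cg; exact: (cvg_pair cf cg). Qed.

Lemma continuous_big_sum {X : topologicalType} (I : Type) (r : seq I)
    (f : I -> X -> R) x : (forall i, {for x, continuous (f i)}) ->
  {for x, continuous (fun y => \sum_(i <- r) f i y)}.
Proof.
move=> cf.
have -> : (fun y => \sum_(i <- r) f i y) = \sum_(i <- r) f i.
  by apply/funext => y; rewrite fct_sumE.
elim/big_ind: _ => [|g h cg ch|i _]; first exact: cst_continuous.
  exact: continuousD.
exact: cf.
Qed.

Lemma continuous_truncation (a : R) : continuous (fun r : R => Num.max r a).
Proof.
move=> r.
exact: (@continuous_max _ _ id (cst a) r (@cvg_id _ _) (@cvg_cst _ _ _ _ _)).
Qed.

(** A Riemann sum of G replaces the integral of the time derivative. *)
Lemma mean_nonpos_increment (F G : R -> E -> R) (a T : R) : a <= T ->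
  (forall t x, a <= t -> is_derive t 1 (F ^~ x) (G t x)) ->
  continuous (fun z : R * E => G (Num.max z.1 a) z.2) ->
  (forall t, a <= t -> periodic2pi (G t)) ->
  (forall t, a <= t -> mean_nonpos (G t)) ->
  mean_nonpos (fun x => F T x - F a x).
Proof.
move=> aT dF cG pG mG; apply: mean_nonpos_approx => d d0.
pose H t := G (Num.max t a).
have Ta0 : 0 <= T - a by rewrite subr_ge0.
have pH t : periodic2pi (H t) by apply: pG; rewrite le_max lexx orbT.
pose e := d / (T - a + 1).
have e0 : 0 < e by rewrite divr_gt0 // ltr_wpDl.
have [r r0 Hr] := uniformly_continuous_periodic (`|a| + `|T|) cG pH e0.
pose N := (Num.bound ((T - a) / r)).+1.
have N0 : 0 < N%:R :> R by rewrite ltr0n.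
pose h := (T - a) / N%:R.
have h0 : 0 <= h by rewrite divr_ge0 // ltW.
have hr : h < r.
  rewrite ltr_pdivrMr // -ltr_pdivrMl // [_^-1 * _]mulrC.
  apply: (lt_le_trans (archi_boundP _)); last by rewrite ler_nat.
  by rewrite divr_ge0 // ltW.
pose s (i : nat) := a + i%:R * h.
have as_ i : a <= s i by rewrite lerDl mulr_ge0.
have sS i : s i.+1 = s i + h by rewrite /s -[i.+1%:R]natr1 mulrDl mul1r addrA.
have sT i : (i <= N)%N -> s i <= T.
  move=> iN; have -> : T = s N by rewrite /s /h mulrC divfK ?gt_eqF // addrC subrK.
  by rewrite lerD2l ler_wpM2r // ler_nat.
have sN : s N = T by rewrite /s /h mulrC divfK ?gt_eqF // addrC subrK.
exists (fun x => \sum_(i < N) h * G (s i.+1) x).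
  by apply: mean_nonpos_sum => i; apply: mean_nonposZ => //; exact: mG.
move=> x.
have step i : (i < N)%N -> F (s i.+1) x - F (s i) x <= h * G (s i.+1) x + h * e.
  move=> iN; have le : s i <= s i.+1 by rewrite sS lerDl.
  have dG (y : R) : y \in `]s i, s i.+1[%R -> is_derive y 1 (F ^~ x) (G y x).
    rewrite in_itv /= => /andP[y1 _]; apply: dF; exact: le_trans (as_ i) (ltW y1).
  have cF : {within `[s i, s i.+1], continuous (F ^~ x)}.
    apply: derivable_within_continuous => y; rewrite in_itv /= => /andP[y1 _].
    by have [] := dF y x (le_trans (as_ i) y1).
  have [c] := MVT_segment le dG cF.
  rewrite in_itv /= => /andP[c1 c2] ->.
  rewrite sS addrAC subrr add0r mulrC -mulrDr ler_wpM2l //.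
  have := Hr c (s i.+1) x; rewrite /H !max_l //; last exact: le_trans (as_ i) c1.
  rewrite -sS => Hc; rewrite -lerBlDl; apply/ltW/(le_lt_trans (ler_norm _))/Hc.
    rewrite ler_norml; apply/andP; split.
      apply: le_trans (le_trans (as_ i) c1).
      by rewrite opprD; have := ler_norm (- a); rewrite normrN; have := normr_ge0 T; lra.
    apply: (le_trans c2); apply: (le_trans (sT _ iN)).
    by have := ler_norm T; have := normr_ge0 a; lra.
  rewrite ltr_norml; apply/andP; split; move: c1 c2; rewrite sS; lra.
have -> : F T x - F a x = \sum_(i < N) (F (s i.+1) x - F (s i) x).
  rewrite -(big_mkord xpredT (fun i => F (s i.+1) x - F (s i) x)).
  by rewrite telescope_sumr // sN /s mul0r addr0.
apply: (@le_trans _ _ (\sum_(i < N) (h * G (s i.+1) x + h * e))).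
  by apply: ler_sum => i _; exact: step.
rewrite big_split /= lerD2l sumr_const card_ord -mulr_natl mulrA.
have -> : N%:R * h = T - a by rewrite /h mulrC divfK ?gt_eqF.
rewrite /e mulrA ler_pdivrMr ?ltr_wpDl // mulrC ler_pM2l //; lra.
Qed.

(** The derivative exists at positive times only: the evolution is followed from
    a > 0 on, and F a tends to F 0 = 0 uniformly as a tends to 0. *)
Lemma zero_evolution (F G : R -> E -> R) :
  (forall (t : R) x, 0 < t -> is_derive t 1 (F ^~ x) (G t x)) ->
  continuous (fun z : R * E => F (Num.max z.1 0) z.2) ->
  (forall z : R * E, 0 < z.1 -> {for z, continuous (fun z => G z.1 z.2)}) ->
  (forall t, 0 <= t -> periodic2pi (F t)) ->
  (forall t, 0 < t -> periodic2pi (G t)) ->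
  (forall t, 0 < t -> mean_nonpos (G t)) ->
  (forall x, F 0 x = 0) -> (forall t x, 0 <= t -> 0 <= F t x) ->
  forall t x, 0 <= t -> F t x = 0.
Proof.
move=> dF cF cG pF pG mG F0 Fp T x.
rewrite le_eqVlt => /predU1P[<-//|T0].
have pH t : periodic2pi (F (Num.max t 0)) by apply: pF; rewrite le_max lexx orbT.
have cFT : continuous (F T).
  move=> y; have -> : F T = (fun z : R * E => F (Num.max z.1 0) z.2) \o (pair T).
    by apply/funext => y' /=; rewrite max_l // ltW.
  apply: (@continuous_comp _ _ _ (pair T) (fun z : R * E => F (Num.max z.1 0) z.2)).
    have c1 : {for y, continuous (fun _ : E => T : R)} by exact: cst_continuous.
    have c2 : {for y, continuous (fun y : E => y)} by exact: cvg_id.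
    exact: (continuous_pair c1 c2).
  exact: cF.
apply: (mean_nonpos_eq0 cFT (pF _ (ltW T0)) (fun y => Fp T y (ltW T0))).
apply: mean_nonpos_approx => d d0.
have [r r0 Hr] := uniformly_continuous_periodic 0 cF pH d0.
pose a := Num.min (r / 2) T.
have a0 : 0 < a by rewrite lt_min T0 divr_gt0.
have ar : a < r by rewrite gt_min ltr_pdivrMr // ltr_pMr // ltr1n.
exists (fun y => F T y - F a y).
  apply: (@mean_nonpos_increment F G).
  - by rewrite ge_min lexx orbT.
  - by move=> t y ta; apply: dF; exact: lt_le_trans a0 ta.
  - move=> z; apply: (@continuous_comp _ _ _
      (fun z : R * E => (Num.max z.1 a, z.2)) (fun z => G z.1 z.2)).
      apply: continuous_pair; last exact: cvg_snd.
      apply: (@continuous_comp _ _ _ fst (fun r : R => Num.max r a)).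
        exact: cvg_fst.
      exact: continuous_truncation.
    by apply: cG; rewrite /= lt_max a0 orbT.
  - by move=> t ta; apply: pG; exact: lt_le_trans a0 ta.
  - by move=> t ta; apply: mG; exact: lt_le_trans a0 ta.
move=> y; rewrite -lerBlDl opprB addrC subrK.
have := Hr 0 a y; rewrite normr0 lexx sub0r normrN gtr0_norm // => /(_ isT ar).
rewrite maxxx F0 sub0r normrN max_l ?(ltW a0) //.
by move/ltW; apply: le_trans; exact: ler_norm.
Qed.

End Evolution.

(** * Functions on the closed half-space *)

Section HalfSpace.
Context {R : realType}.
Local Notation E := 'rV[R]_3.
Implicit Types (f g : R -> E -> R) (t : R).

(** Clamping the time at 0 turns continuity on the closed half-space into
    continuity on the whole space, where uniform continuity is available. *)
Lemma continuous_half_space_clamped f : continuous_half_space f ->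
  continuous (fun z : R * E => f (Num.max z.1 0) z.2).
Proof.
move=> /subspace_continuousP cf z.
pose clamp (y : R * E) := (Num.max y.1 0, y.2).
have hc y : half_space (clamp y) by rewrite /half_space /= le_max lexx orbT.
have cc : {for z, continuous clamp}.
  apply: continuous_pair; last exact: cvg_snd.
  apply: (@continuous_comp _ _ _ fst (fun r : R => Num.max r 0)).
    exact: cvg_fst.
  exact: continuous_truncation.
move=> U /(cf (clamp z) (hc z)) /= nU.
by apply: (@filterS _ (nbhs z) _ _ _ _ (cc _ nU)) => y /(_ (hc y)).
Qed.

Lemma near_pos_fst (z : R * E) : 0 < z.1 -> \forall y \near z, 0 < y.1.
Proof.
move=> z0; have c : {for z, continuous (@fst R E)} by exact: cvg_fst.
exact: (c _ (lt_nbhsr z0)).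
Qed.

Lemma continuous_interior f (z : R * E) : continuous_half_space f -> 0 < z.1 ->
  {for z, continuous (fun z => f z.1 z.2)}.
Proof.
move=> cf z0.
have : {for z, continuous (fun z : R * E => f (Num.max z.1 0) z.2)}.
  exact: continuous_half_space_clamped.
rewrite /prop_for /continuous_at max_l ?(ltW z0) // => H.
apply: cvg_trans H; apply: near_eq_cvg.
by apply: (@filterS _ (nbhs z) _ _ _ _ (near_pos_fst z0)) => y y0 /=; rewrite max_l // ltW.
Qed.

Lemma near_pos (t : R) (P : R -> Prop) : 0 < t -> (forall s, 0 < s -> P s) ->
  \near t, P t.
Proof. by move=> t0 HP; exact: filterS HP (lt_nbhsr t0). Qed.

Lemma continuous_stpartials f s (z : R * E) : smooth_half_space f -> 0 < z.1 ->
  {for z, continuous (fun z => stpartials s f z.1 z.2)}.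
Proof.
move=> [_ sf] z0; have [_ [g cg eg]] := sf s.
have := continuous_interior cg z0.
rewrite /prop_for /continuous_at /= eg // => H; apply: cvg_trans H; apply: near_eq_cvg.
by apply: (@filterS _ (nbhs z) _ _ _ _ (near_pos_fst z0)) => y y0; rewrite /= eg.
Qed.

Lemma stpartials_Some s f t :
  stpartials [seq Some j | j <- s] f t = partials s (f t).
Proof. by elim: s => //= j s <-. Qed.

Lemma smooth_slice f t : smooth_half_space f -> 0 < t -> smooth (f t).
Proof.
move=> sf t0 s; split=> [x|x j].
  rewrite -(stpartials_Some s f t).
  apply: (@continuous_comp _ _ _ (pair t)
    (fun z : R * E => stpartials [seq Some j | j <- s] f z.1 z.2)).
    have c1 : {for x, continuous (fun _ : E => t : R)} by exact: cst_continuous.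
    have c2 : {for x, continuous (fun y : E => y)} by exact: cvg_id.
    exact: (continuous_pair c1 c2).
  exact: (@continuous_stpartials f _ (t, x)).
have := (sf.2 [seq Some j | j <- s]).1 (Some j) t x t0.
by rewrite /= stpartials_Some.
Qed.

Lemma is_derive_time f (t : R) x : smooth_half_space f -> 0 < t ->
  is_derive t 1 (f ^~ x) (dt f t x).
Proof.
move=> [_ sf] t0; rewrite /dt derive1E; apply/derivableP.
exact: ((sf [::]).1 None t x t0).
Qed.

Lemma dt_eq f g t x y : 0 < t -> (forall s, 0 < s -> f s x = g s y) ->
  dt f t x = dt g t y.
Proof.
by move=> t0 fg; rewrite /dt !derive1E; apply: near_eq_derive; exact: near_pos.
Qed.

Lemma dt_periodic f t : (forall t, 0 <= t -> periodic2pi (f t)) -> 0 < t ->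
  periodic2pi (dt f t).
Proof. by move=> pf t0 x j; apply: dt_eq => // s s0; apply: pf; exact: ltW. Qed.

Lemma constant_of_partials0 (f : E -> R) x y : smooth f ->
  (forall j z, partial j f z = 0) -> f x = f y.
Proof.
move=> sf f0.
have step j (a : R) z : f (z + a *: basis_vec j) = f z.
  have [c _] := mvt_line z a (fun y => @smooth_derivable _ f y j sf).
  by rewrite -/(partial j f _) f0 mulr0 => /eqP; rewrite subr_eq0 => /eqP.
have -> : y = x + \sum_j (y - x) 0 j *: basis_vec j.
  have -> : \sum_j (y - x) 0 j *: basis_vec j = y - x.
    by rewrite row_basis; apply/rowP => j; rewrite mxE.
  by rewrite addrC subrK.
elim: (index_enum _) => [|j s IH]; first by rewrite big_nil addr0.
by rewrite big_cons [X in x + X]addrC addrA step.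
Qed.

End HalfSpace.

(** * Uniqueness of solutions *)

Section Uniqueness.
Context {R : realType}.
Local Notation E := 'rV[R]_3.
Implicit Types (nu M t : R) (u v : R -> E -> E) (P Q : R -> E -> R).

Local Opaque partial.

(** Gronwall's argument: with the weight exp (- 6 M t), the energy inequality for
    the difference w says that the time derivative of F has nonpositive mean. *)
Lemma NS_unique nu (u0 : E -> E) u P v Q M : 0 <= nu ->
  NS_solution nu u0 u P -> NS_solution nu u0 v Q ->
  (forall t x j k, 0 < t -> `|partial k (ucomp j (u t)) x| <= M) ->
  forall t x, 0 <= t -> u t x = v t x.
Proof.
move=> nu0 [[su sP] pu mu du iu] [[sv sQ] pv mv dv iv] gM.
pose c := 6 * M.
pose w j t : E -> R := ucomp j (v t) - ucomp j (u t).
pose a j t (x : E) := dt (fun s => ucomp j (v s)) t x - dt (fun s => ucomp j (u s)) t x.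
pose F t x := expR (- c * t) * \sum_j w j t x * w j t x.
pose G t x := expR (- c * t) *
  (\sum_j 2 * w j t x * a j t x - c * \sum_j w j t x * w j t x).
have dw t x j : 0 < t -> is_derive t 1 (fun s => w j s x) (a j t x).
  by move=> t0; apply: is_deriveB; exact: is_derive_time.
suff F0 t x : 0 <= t -> F t x = 0.
  move=> t x t0; apply/rowP => j; have := F0 t x t0.
  move/eqP; rewrite mulf_eq0 gt_eqF ?expR_gt0 //= psumr_eq0; last first.
    by move=> i _; rewrite -expr2 sqr_ge0.
  move/allP/(_ j (mem_index_enum j)); rewrite /= mulf_eq0 orbb /w !fctE subr_eq0.
  by move/eqP => e; exact: esym e.
move: t x; apply: (@zero_evolution _ F G).
- move=> t x t0.
  have d1 := is_derive_decaying c (cst 1) t (x : E).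
  have d2 := is_derive_sum (fun j => is_deriveM (dw t x j t0) (dw t x j t0)).
  have -> : F ^~ x = (fun s => decaying c (cst 1) s x) *
      \sum_j ((fun s => w j s x) * (fun s => w j s x)).
    by apply/funext => s; rewrite /F /decaying !fctE fct_sumE mulr1.
  apply: is_derive_eq (is_deriveM d1 d2) _.
  rewrite /G /decaying fct_sumE /= mulr1.
  have -> : \sum_j (w j t x *: a j t x + w j t x *: a j t x) =
      \sum_j 2 * w j t x * a j t x.
    by apply: eq_bigr => j _; rewrite -mulrA mulr_natl mulr2n.
  have H (e S D : R) : e *: D + S *: (e * (- c * 1)) = e * (D - c * S).
    by rewrite /GRing.scale /=; ring.
  exact: H.
- have cw j : continuous (fun z : R * E => w j (Num.max z.1 0) z.2).
    have c1 := continuous_half_space_clamped (sv j).1.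
    have c2 := continuous_half_space_clamped (su j).1.
    by move=> z; exact: (continuousB (c1 z) (c2 z)).
  move=> z.
  have ce : {for z, continuous (fun z : R * E => expR (- c * Num.max z.1 0))}.
    apply: (@continuous_comp _ _ _ (fun z : R * E => (Num.max z.1 0, z.2))
      (fun z : R * E => expR (- c * z.1))); last exact: continuous_exp_time.
    apply: continuous_pair; last exact: cvg_snd.
    apply: (@continuous_comp _ _ _ fst (fun r : R => Num.max r 0)).
      exact: cvg_fst.
    exact: continuous_truncation.
  have cS : {for z, continuous (fun z : R * E =>
      \sum_j w j (Num.max z.1 0) z.2 * w j (Num.max z.1 0) z.2)}.
    apply: continuous_big_sum => j; exact: (continuousM (cw j z) (cw j z)).
  exact: (continuousM ce cS).
- move=> z z0.
  have ci f : smooth_half_space f -> {for z, continuous (fun z : R * E => f z.1 z.2)}.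
    by move=> [cf _]; exact: continuous_interior.
  have cd f : smooth_half_space f ->
      {for z, continuous (fun z : R * E => dt f z.1 z.2)}.
    by move=> sf; exact: (@continuous_stpartials _ f [:: None] z sf z0).
  have cw j : {for z, continuous (fun z : R * E => w j z.1 z.2)}.
    exact: (continuousB (ci _ (sv j)) (ci _ (su j))).
  have ca j : {for z, continuous (fun z : R * E => a j z.1 z.2)}.
    exact: (continuousB (cd _ (sv j)) (cd _ (su j))).
  have cS : {for z, continuous (fun z : R * E => \sum_j w j z.1 z.2 * w j z.1 z.2)}.
    apply: continuous_big_sum => j; exact: (continuousM (cw j) (cw j)).
  have cD : {for z, continuous (fun z : R * E => \sum_j 2 * w j z.1 z.2 * a j z.1 z.2)}.
    apply: continuous_big_sum => j.
    exact: (continuousM (continuousM (@cst_continuous _ R (2 : R) z) (cw j)) (ca j)).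
  exact: (continuousM (@continuous_exp_time _ c z)
    (continuousB cD (continuousM (@cst_continuous _ R c z) cS))).
- move=> t t0 x k; rewrite /F; congr (_ * _); apply: eq_bigr => j _.
  by rewrite /w !fctE /ucomp (pv t t0).1 (pu t t0).1.
- move=> t t0 x k; have [t0' pa] : 0 <= t /\
      forall j, a j t (x + (2 * pi) *: basis_vec k) = a j t x.
    split; first exact: ltW.
    move=> j; congr (_ - _); apply: dt_periodic => // s s0 y i.
      by rewrite /ucomp (pv s s0).1.
    by rewrite /ucomp (pu s s0).1.
  have pw j : w j t (x + (2 * pi) *: basis_vec k) = w j t x.
    by rewrite /w !fctE /ucomp (pv t t0').1 (pu t t0').1.
  rewrite /G; under eq_bigr do rewrite pw pa.
  by under [X in _ - _ * X]eq_bigr do rewrite pw.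
- move=> t t0; apply: mean_nonposZ; first exact: expR_ge0.
  have t0' := ltW t0.
  have svt j := smooth_slice (sv j) t0; have sut j := smooth_slice (su j) t0.
  have sPt := smooth_slice sP t0; have sQt := smooth_slice sQ t0.
  apply: (@energy_inequality _ nu M (u t) (v t) (Q t - P t) (a^~ t) nu0 sut svt
    (smoothB sQt sPt)).
  - exact: (pu t t0').1.
  - exact: (pv t t0').1.
  - by move=> x k; rewrite !fctE (pu t t0').2 (pv t t0').2.
  - by move=> x; exact: du.
  - by move=> x; exact: dv.
  - by move=> j k x; exact: gM.
  - move=> j x; rewrite (partialB j sQt sPt) -scaleN1r.
    rewrite (laplacianD (svt j) (smoothZ (-1) (sut j))) (laplacianZ (-1) (sut j)).
    move: (mu t x j t0) (mv t x j t0).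
    rewrite /NS_momentum /a /= => e1 e2.
    have H (A B C D A' B' C' D' : R) :
        A - nu * B + C + D = 0 -> A' - nu * B' + C' + D' = 0 ->
        A' - A = nu * (B' + -1 * B) - C' + C - (D' - D) by clear; lra.
    exact: H e1 e2.
- by move=> x; rewrite /F big1 ?mulr0 // => j _; rewrite /w !fctE /ucomp iu iv subrr mul0r.
- move=> t x _; rewrite mulr_ge0 ?expR_ge0 // sumr_ge0 // => j _.
  by rewrite -expr2 sqr_ge0.
Qed.

End Uniqueness.

(** * Well-posedness *)

Section WellPosedness.
Context {R : realType}.
Local Notation E := 'rV[R]_3.
Implicit Types (nu l t : R) (u v : R -> E -> E) (P Q : R -> E -> R).

Local Opaque partial.

(** The momentum equations give equal pressure gradients at positive times;
    time 0 follows by continuity. *)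
Lemma NS_pressure_unique nu (u0 : E -> E) u P v Q :
  NS_solution nu u0 u P -> NS_solution nu u0 v Q ->
  (forall t x, 0 <= t -> u t x = v t x) ->
  forall t x y, 0 <= t -> P t x - Q t x = P t y - Q t y.
Proof.
move=> [[_ sP] _ mu _ _] [[_ sQ] _ mv _ _] uv.
have pos t x y : 0 < t -> P t x - Q t x = P t y - Q t y.
  move=> t0; have sPt := smooth_slice sP t0; have sQt := smooth_slice sQ t0.
  apply: (@constant_of_partials0 _ (P t - Q t)); first exact: smoothB.
  move=> j z; rewrite partialB; try smooth_shape.
  move: (mu t z j t0) (mv t z j t0); rewrite /NS_momentum.
  have -> : v t = u t by apply/funext => w; rewrite uv // ltW.
  rewrite (@dt_eq _ (fun s => ucomp j (v s)) (fun s => ucomp j (u s)) t z z t0).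
    have H (A p q : R) : A + p = 0 -> A + q = 0 -> p - q = 0 by clear; lra.
    exact: H.
  by move=> s s0; rewrite /ucomp uv // ltW.
move=> t x y; rewrite le_eqVlt => /predU1P[<-|]; last exact: pos.
pose K s := P s x - Q s x - (P s y - Q s y).
suff : K 0 = 0 by move/eqP; rewrite subr_eq0 => /eqP.
have cP := continuous_half_space_clamped sP.1.
have cQ := continuous_half_space_clamped sQ.1.
have cl f (w : E) : continuous (fun z : R * E => f (Num.max z.1 0) z.2) ->
    {for 0, continuous (fun s : R => f (Num.max s 0) w : R)}.
  move=> cf; apply: (@continuous_comp _ _ _ (fun s : R => (s, w))
    (fun z : R * E => f (Num.max z.1 0) z.2)); last exact: cf.
  have c1 : {for 0, continuous (fun s : R => s)} by exact: cvg_id.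
  have c2 : {for 0, continuous (fun _ : R => w)} by exact: cst_continuous.
  exact: (continuous_pair c1 c2).
have cK : {for 0, continuous (fun s : R => K (Num.max s 0))}.
  exact: (continuousB (continuousB (cl P x cP) (cl Q x cQ))
                      (continuousB (cl P y cP) (cl Q y cQ))).
apply/eqP/negPn/negP => K0.
have k0 : 0 < `|K 0| by rewrite normr_gt0.
have /cvgrPdist_lt/(_ _ k0)/nbhs_ballP[r /= r0 Hr] := cK.
have /Hr : ball (0 : R) r (r / 2).
  by rewrite /ball /= sub0r normrN gtr0_norm ?divr_gt0 // ltr_pdivrMr // ltr_pMr // ltr1n.
have r2 : 0 < r / 2 by rewrite divr_gt0.
by rewrite /= maxxx max_l ?(ltW r2) // {2}/K (pos _ x y r2) subrr subr0 ltxx.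
Qed.

Lemma beltrami_gradient_bounded l (u0 : E -> E) : beltrami l (ucomp^~ u0) ->
  exists M, forall j k x, `|partial k (ucomp j u0) x| <= M.
Proof.
move=> bu.
have /choice[Mf HM] (jk : 'I_3 * 'I_3) :
    exists M, forall x, `|partial jk.2 (ucomp jk.1 u0) x| <= M.
  apply: periodic_bounded.
    exact/smooth_continuous/smooth_partial/(beltrami_smooth bu).
  exact/partial_periodic/(beltrami_periodic bu).
exists (\sum_jk Mf jk) => j k x; apply: le_trans (HM (j, k) x) _.
rewrite (bigD1 (j, k)) //= lerDl; apply: sumr_ge0 => jk _.
exact: le_trans (HM jk x).
Qed.

(** The decaying flow has a bounded gradient, so every solution with the same
    data coincides with it. *)
Lemma beltrami_NS_unique nu l (u0 : E -> E) u P : 0 <= nu ->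
  beltrami l (ucomp^~ u0) -> NS_solution nu u0 u P ->
  forall t, 0 <= t -> u t = decaying_flow (nu * l ^+ 2) u0 t.
Proof.
move=> nu0 bu sol t t0; apply/funext => x; apply/esym.
have [M HM] := beltrami_gradient_bounded bu.
apply: (NS_unique nu0 (beltrami_NS_solution nu bu) sol (M := M)) t0.
move=> s y j k s0; rewrite ucomp_decaying partial_decaying; last first.
  exact: (beltrami_smooth bu j).
rewrite /decaying normrM ger0_norm ?expR_ge0 //.
apply: le_trans (HM j k y); rewrite ler_piMl // expR_le1.
have := ltW s0; rewrite mulNr oppr_le0 => s0'.
by rewrite mulr_ge0 // mulr_ge0 // sqr_ge0.
Qed.

Lemma exp_decay_diff (a b t : R) : 0 <= a -> 0 <= b -> 0 <= t ->
  `|expR (- a * t) - expR (- b * t)| <= `|a - b| * t.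
Proof.
have H (p q : R) : 0 <= p -> p <= q -> 0 <= t ->
    `|expR (- p * t) - expR (- q * t)| <= `|p - q| * t.
  move=> p0 pq t0; rewrite ger0_norm; last first.
    by rewrite subr_ge0 ler_expR ler_wpM2r // lerN2.
  rewrite distrC ger0_norm ?subr_ge0 //.
  have -> : expR (- q * t) = expR (- p * t) * expR (- (q - p) * t).
    by rewrite -expRD; congr expR; ring.
  rewrite -[X in X - _]mulr1 -mulrBr.
  apply: (@le_trans _ _ (1 - expR (- (q - p) * t))).
    rewrite ler_piMl //; last first.
      by rewrite expR_le1 mulNr oppr_le0 mulr_ge0.
    rewrite subr_ge0 expR_le1 mulNr oppr_le0 mulr_ge0 //; lra.
  by have := expR_ge1Dx (- (q - p) * t); lra.
move=> a0 b0 t0; have [ab|ba] := leP a b; first exact: H.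
by rewrite distrC [`|a - b|]distrC; exact: H (ltW ba) t0.
Qed.

(** The eigenvalue is controlled by the data. Writing u and v for the initial
    fields, (k^2 - l^2) v = Lap (u - v) + l^2 (u - v); hence the difference of
    the decay rates, multiplied by v, is small with u - v, even where v is
    small and the rates are far apart. The same holds for all derivatives of u
    and v, at the cost of two more derivatives on the data. *)
Lemma decaying_flow_stable nu l k (u0 v0 : E -> E) t T (m : nat) (d : R) :
  0 <= nu -> 0 <= t <= T ->
  beltrami l (ucomp^~ u0) -> beltrami k (ucomp^~ v0) -> Cclose m.+2 d u0 v0 ->
  Cclose m ((1 + nu * T * (3 + l ^+ 2)) * d)
    (decaying_flow (nu * l ^+ 2) u0 t) (decaying_flow (nu * k ^+ 2) v0 t).
Proof.
move=> nu0 /andP[t0 tT] bu bv cl s sm x j.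
set U := ucomp j u0; set V := ucomp j v0.
have sU : smooth U := beltrami_smooth bu j.
have sV : smooth V := beltrami_smooth bv j.
have dec (a : R) (W : E -> R) : smooth W ->
    partials s (decaying a W t) x = expR (- a * t) * partials s W x.
  by move=> sW; have := congr1 (fun f => f x) (partialsZ s (expR (- a * t)) sW).
rewrite !ucomp_decaying (dec _ _ sU) (dec _ _ sV).
have lap (h : R) (W : E -> R) : smooth W -> laplacian W = - h ^+ 2 *: W ->
    \sum_i partial i (partial i (partials s W)) x = - h ^+ 2 * partials s W x.
  move=> sW eW; have := congr1 (fun f => f x) (partials_laplacian s sW).
  by rewrite eW partialsZ // => <-.
have lU := lap l U sU (beltrami_laplacian bu j).
have lV := lap k V sV (beltrami_laplacian bv j).
set p := partials s U x in lU *; set q := partials s V x in lV *.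
have pq : `|p - q| < d.
  by apply: cl; exact: leq_trans sm (leq_trans (leqnSn _) (leqnSn _)).
have d0 : 0 < d by exact: le_lt_trans pq.
have lq : `|(k ^+ 2 - l ^+ 2) * q| <= (3 + l ^+ 2) * d.
  have -> : (k ^+ 2 - l ^+ 2) * q =
      \sum_i (partial i (partial i (partials s U)) x
              - partial i (partial i (partials s V)) x) + l ^+ 2 * (p - q).
    have H (r s' : R) : (k ^+ 2 - l ^+ 2) * s' =
        - l ^+ 2 * r - - k ^+ 2 * s' + l ^+ 2 * (r - s') by clear; ring.
    by apply: etrans (H p q) _; rewrite sumrB; congr (_ - _ + _); exact: esym.
  apply: le_trans (ler_normD _ _) _; rewrite mulrDl lerD //.
    apply: le_trans (ler_norm_sum _ _ _) _.
    have -> : 3 * d = \sum_(i < 3) d by rewrite sumr_const card_ord mulr_natl.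
    by apply: ler_sum => i _; apply/ltW/(cl [:: i, i & s]).
  by rewrite normrM (ger0_norm (sqr_ge0 l)) ler_wpM2l ?sqr_ge0 // ltW.
have -> : expR (- (nu * l ^+ 2) * t) * p - expR (- (nu * k ^+ 2) * t) * q =
    expR (- (nu * l ^+ 2) * t) * (p - q) +
    (expR (- (nu * l ^+ 2) * t) - expR (- (nu * k ^+ 2) * t)) * q by ring.
apply: le_lt_trans (ler_normD _ _) _; rewrite [ltRHS]mulrDl mul1r ltr_leD //.
  apply: le_lt_trans pq; rewrite normrM ger0_norm ?expR_ge0 //.
  rewrite ler_piMl // expR_le1 mulNr oppr_le0.
  by rewrite mulr_ge0 // mulr_ge0 // sqr_ge0.
have nl (h : R) : 0 <= nu * h ^+ 2 by rewrite mulr_ge0 // sqr_ge0.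
rewrite normrM; apply: (@le_trans _ _ (nu * t * `|(k ^+ 2 - l ^+ 2) * q|)).
  rewrite [`|(k ^+ 2 - _) * q|]normrM [leRHS]mulrA ler_wpM2r //.
  apply: le_trans (exp_decay_diff (nl l) (nl k) t0) _.
  by rewrite -mulrBr normrM (ger0_norm nu0) distrC mulrAC.
rewrite -!mulrA ler_wpM2l //; apply: ler_pM => //.
Qed.

End WellPosedness.

Theorem corollary1p5 (R : realType) (nu : R) (lam : nat -> R)
  (hnu : 0 < nu) (hlam : eigenvalue_enumeration lam) :
  globally_well_posed nu (initial_data_B lam).
Proof.
split=> [u0 Bu|u0 Bu u P v Q su sv|u0 Bu T m e T0 e0].
- have [l bu] := initial_data_beltrami Bu.
  by do 2 eexists; exact: beltrami_NS_solution bu.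
- have [l bu] := initial_data_beltrami Bu; have nu0 := ltW hnu.
  have uv t x : 0 <= t -> u t x = v t x.
    move=> t0; rewrite (beltrami_NS_unique nu0 bu su t0).
    by rewrite (beltrami_NS_unique nu0 bu sv t0).
  by split=> //; exact: NS_pressure_unique su sv uv.
have [l bu] := initial_data_beltrami Bu; have nu0 := ltW hnu.
pose C := 1 + nu * T * (3 + l ^+ 2).
have C0 : 0 < C.
  rewrite ltr_wpDr // mulr_ge0 //; first by rewrite mulr_ge0 // ltW.
  by rewrite addr_ge0 // sqr_ge0.
exists m.+2; exists (e / C) => [|v0 Bv cl u P v Q su sv t tT].
  by rewrite divr_gt0.
have [k bv] := initial_data_beltrami Bv; have /andP[t0 _] := tT.
rewrite (beltrami_NS_unique nu0 bu su t0) (beltrami_NS_unique nu0 bv sv t0).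
have := decaying_flow_stable nu0 tT bu bv cl.
by rewrite -/C mulrC divfK // gt_eqF.
Qed.
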